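(* Let $n,s$ be integers satisfying $s\leq \frac{n}{2^{17}\log n}$. Let $\mathcal{F}\subset \mathcal D_n$ be a family of derangements such that $\nu(\mathcal{F})<s$. Then $|\mathcal{F}|\leq (s-1)d_{n,1}$. Moreover, in the case of equality, $\mathcal{F}$ is of the form $\bigcup_{i=1}^{s-1}\mathcal D_n[(x,y_i)]$ or $\bigcup_{i=1}^{s-1}\mathcal D_n[(x_i,y)]$, where the $y_i$'s, respectively the $x_i$'s, are distinct and all the pairs $(x,y_i)$, respectively $(x_i,y)$, are off-diagonal (i.e. have distinct coordinates).
   Context: $\Sigma_n$ is the set of permutations of $[n]$; a permutation is identified with its graph $\{(i,\sigma(i))\}\subset[n]^2$, two permutations intersect iff they agree at some point, and $\nu(\mathcal{F})$ is the maximum number of pairwise non-intersecting members of $\mathcal{F}$. $\mathcal D_n$ is the set of derangements (permutations with no fixed point). For a pair $(x,y)$, $\mathcal D_n[(x,y)]$ is the set of derangements $\pi$ with $\pi(x)=y$, and $d_{n,1}:=|\mathcal D_n[(x,y)]|$ for any $x\ne y$ (this does not depend on the choice of $x\neq y$). *)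

(* Defs.v *)
From mathcomp Require Import all_boot all_fingroup.
From Stdlib Require Import Reals.

Set Implicit Arguments.
Unset Strict Implicit.
Unset Printing Implicit Defensive.

Definition derangement n (s : {perm 'I_n}) : bool := [forall i, s i != i].

Definition Dn n : {set {perm 'I_n}} := [set s | derangement s].

Definition Dpair n (x y : 'I_n) : {set {perm 'I_n}} :=
  [set s | derangement s && (s x == y)].

Definition intersecting n (s t : {perm 'I_n}) : bool := [exists i, s i == t i].

Definition pairwise_nonintersecting n (G : {set {perm 'I_n}}) : bool :=
  [forall s in G, forall t in G, (s != t) ==> ~~ intersecting s t].

Definition nu n (F : {set {perm 'I_n}}) : nat :=
  \max_(G : {set {perm 'I_n}} | (G \subset F) && pairwise_nonintersecting G) #|G|.

(* d_{n,1} = |D_n[(x,y)]| for x <> y; computed with x = 0, y = 1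
   (the value is independent of the choice; it is 0 when n < 2,
   where no off-diagonal pair exists). *)
Definition d_n1 n : nat :=
  #|[set s : {perm 'I_n} | derangement s &&
      [exists x : 'I_n, (val x == 0) && (val (s x) == 1)]]|.

(* Main.v *)
(** Identify a permutation with its graph.  Call a pair [e] dense when [F] contains almost
    all derangements through [e], and let [E] be the set of dense pairs.

    The engine is the spread lemma: families in which every set [Z] has relative degree at
    most [R ^ - #|Z|], with [R] of order [s log n], have pairwise disjoint representatives.
    Colour the ground set at random; inside its own colours, each family is thinned round by
    round, replacing its sets by minimal fragments, whose size is halved in most rounds.

    The stars of dense pairs are spread, so [#|E| < s].  The members of [F] avoiding [E] are,
    up to a negligible remainder, covered by kernels of size at most [log n] carrying spread
    subfamilies; the spread lemma forbids [s - #|E|] disjoint kernels.  Peeling the kernels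
    from large to small sizes leaves at most [u = s - 1 - #|E|] single pairs, none of them dense,
    plus lower order terms.  Hence the members of [F] avoiding [E] number less than
    [u * d_n1 n] when [u > 0].  When [u = 0], a permutation of [F] avoiding [E] would extend
    to [s] disjoint members of [F]: a switching argument shows that a positive proportion of
    each dense star avoids it, and these parts are still spread.  So [F] is covered by the
    stars of the [s - 1] dense pairs, and equality forces these to be full and pairwise
    disjoint, i.e. the pairs to be collinear. *)

From Stdlib Require Import Reals Lra Lia.
From mathcomp Require Import all_boot all_fingroup.
From mathcomp Require Import zify_ssreflect.
Require Import Defs.

(* [zify_ssreflect] rebinds the key [%R] to a ring scope. *)
Delimit Scope R_scope with R.

Set Implicit Arguments.
Unset Strict Implicit.
Unset Printing Implicit Defensive.

Lemma expnS_bernoulli k i : k.+1 ^ i * (k.+1 - i) <= k.+1 * k ^ i.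
Proof.
elim: i => [|i IHi]; first by rewrite !expn0 mul1n muln1; lia.
by rewrite !expnS; have := leq_mul (leqnn k) IHi; nia.
Qed.

Lemma expSn_le_double k i : i.*2 <= k.+1 -> k.+1 ^ i <= 2 * k ^ i.
Proof.
case: i => [|i] ik //; have := expnS_bernoulli k i.+1.
have : k.+1 <= 2 * (k.+1 - i.+1) by lia.
have : 0 < k.+1 ^ i.+1 by rewrite expn_gt0.
nia.
Qed.

Lemma expSn_le_quadruple n i : i <= n -> n.+1 ^ i <= 4 * n ^ i.
Proof.
move=> le_in; have -> : i = i./2 + uphalf i by lia.
have := leq_mul (@expSn_le_double n i./2 _) (@expSn_le_double n (uphalf i) _).
by rewrite mulnACA -!expnD; apply; lia.
Qed.

Lemma expn_le_ffact n i : i <= n -> n ^ i <= 4 ^ i * n ^_ i.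
Proof.
elim: n i => [|n IHn] [|i] //; rewrite ltnS => le_in.
have := leq_trans (expSn_le_quadruple le_in) (leq_mul (leqnn 4) (IHn _ le_in)).
by rewrite ffactnS /= !expnS => /(leq_mul (leqnn n.+1)); nia.
Qed.

Lemma expn_fact_le b n i : i <= n -> 4 * b <= n -> b ^ i * (n - i)`! <= n`!.
Proof.
case: i => [|i] le_in le_bn; first by rewrite mul1n subn0.
rewrite -(ffact_fact le_in) leq_mul2r -(@leq_pmul2l (4 ^ i.+1)) ?expn_gt0 //.
by rewrite -expnMn (leq_trans _ (expn_le_ffact le_in)) ?leq_exp2r ?orbT.
Qed.

Lemma sum_geometric_le (x : nat -> nat) (K m : nat) :
  (forall j, 2 <= j < m.+2 -> x j * 2 ^ j.-1 <= K) -> \sum_(2 <= j < m.+2) x j <= K.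
Proof.
move=> xK; suff: (\sum_(2 <= j < m.+2) x j) * 2 ^ m + K <= K * 2 ^ m.
  by move/(leq_trans (leq_addr _ _)); rewrite leq_pmul2r ?expn_gt0.
elim: m xK => [|m IHm] xK; first by rewrite big_geq // mul0n muln1.
have IHsum : (\sum_(2 <= j < m.+2) x j) * 2 ^ m + K <= K * 2 ^ m.
  by apply: IHm => j /andP[j2 jm]; rewrite xK // j2 leqW.
have last_le : x m.+2 * (2 * 2 ^ m) <= K by rewrite -expnS xK //= ltnSn.
by rewrite big_nat_recr //= mulnDl expnS; lia.
Qed.

Lemma leq_sum_inj (I J : finType) (P : pred I) (Q : pred J) (h : I -> J)
    (E : I -> nat) (F : J -> nat) :
  {in P &, injective h} -> (forall i, P i -> Q (h i) /\ E i <= F (h i)) ->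
  \sum_(i | P i) E i <= \sum_(j | Q j) F j.
Proof.
move=> h_inj PQ; apply: (@leq_trans (\sum_(i | P i) F (h i))).
  by apply: leq_sum => i /PQ[].
rewrite -(big_imset F h_inj) [leqRHS](bigID [in h @: P]) /= -[leqLHS]addn0 leq_add //.
rewrite leq_eqVlt; apply/orP; left; apply/eqP/eq_bigl => j.
by apply/idP/andP => [|[]] // jP; split=> //; case/imsetP: jP => i /PQ[Qhi _] ->.
Qed.

Lemma sum_subsets_exp (X : finType) (D : {set X}) q :
  \sum_(W in powerset D) q ^ #|D :\: W| = q.+1 ^ #|D|.
Proof.
rewrite -addn1 expnDn (partition_big (fun W : {set X} => inord #|W| : 'I_#|D|.+1) predT) //=.
apply: eq_bigr => i _; rewrite exp1n muln1 -cards_draws -sum_nat_const.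
apply: eq_big => W; rewrite !inE.
  have [WD|] //= := boolP (W \subset D).
  by rewrite -val_eqE /= inordK // ltnS subset_leq_card.
by case/andP=> WD /eqP <-; rewrite inordK ?cardsDS // ltnS subset_leq_card.
Qed.

Lemma leq_card_bigcup (I T : finType) (P : pred I) (F : I -> {set T}) :
  #|\bigcup_(i | P i) F i| <= \sum_(i | P i) #|F i|.
Proof.
elim/big_rec2: _ => [|i m B _ IHB]; first by rewrite cards0.
by apply: leq_trans (leq_card_setU _ _) _; rewrite leq_add2l.
Qed.

Lemma leq_card_bigcup_const (I T : finType) (P : pred I) (F : I -> {set T}) c :
  (forall i, P i -> #|F i| <= c) -> #|\bigcup_(i | P i) F i| <= #|P| * c.
Proof.
by move=> Fc; rewrite -sum_nat_const (leq_trans (leq_card_bigcup _ _)) ?leq_sum.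
Qed.

Lemma exists_notin_bigcup (I T : finType) (F : I -> {set T}) :
  \sum_i #|F i| < #|T| -> exists x, forall i, x \notin F i.
Proof.
move/(leq_ltn_trans (leq_card_bigcup predT F)); rewrite -cardsT => lt_FT.
have : \bigcup_i F i != [set: T] by apply: contraTneq lt_FT => ->; rewrite ltnn.
rewrite -subTset => /subsetPn[x _ xF]; exists x => i.
by apply: contra xF => xFi; apply/bigcupP; exists i.
Qed.

Lemma card_bigcup_tight (I T : finType) (E : {set I}) (F : I -> {set T}) c :
  (forall i, i \in E -> #|F i| <= c) -> #|E| * c <= #|\bigcup_(i in E) F i| ->
  (forall i, i \in E -> #|F i| = c)
  /\ {in E &, forall i j, i != j -> [disjoint F i & F j]}.
Proof.
move=> Fc tight; pose rest i := \bigcup_(j in E | j != i) F j.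
have tight_at i : i \in E -> #|F i| = c /\ #|F i :&: rest i| = 0.
  move=> iE; have := cardsUI (F i) (rest i); move: tight; rewrite (bigD1 i iE) /=.
  have : #|rest i| <= #|E :\ i| * c.
    rewrite (eq_card (B := [pred j | (j \in E) && (j != i)])) => [|j]; last first.
      by rewrite !inE andbC.
    by apply: leq_card_bigcup_const => j /andP[/Fc].
  by rewrite (cardsD1 i E) iE mulnDl mul1n; have := Fc i iE; rewrite -/(rest i); lia.
split=> [i /tight_at[] //|i j iE jE neq_ij].
have [_ /cards0_eq/eqP] := tight_at i iE; rewrite setI_eq0; apply: disjointWr.
by apply: bigcup_sup; rewrite jE eq_sym.
Qed.

(** * Spread families *)

Lemma disjoint_setID (X : finType) (A S B : {set X}) :
  [disjoint A & B] = [disjoint A :&: S & B] && [disjoint A :\: S & B].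
Proof. by rewrite -{1}(setID A S) -!setI_eq0 setIUl setU_eq0. Qed.

Section SpreadFamilies.

Variables (X I : finType).
Implicit Types (T U : I -> {set X}) (A B : {set I}) (S Y Z : {set X}).

Definition star T A Z : {set I} := [set a in A | Z \subset T a].

Definition link T S (a : I) : {set X} := T a :\: S.

(* [M] is kept apart from [#|A|]: thinning removes members of [A] at constant [M]. *)
Definition spread T A R M : bool := [forall Z, #|star T A Z| * R ^ #|Z| <= M].

Definition bounded_in T A (D : {set X}) k : Prop :=
  forall a, a \in A -> T a \subset D /\ #|T a| <= k.

Definition completes T A U B (W : {set X}) : Prop :=
  forall b, b \in B -> exists2 a, a \in A & T a \subset U b :|: W.

Lemma mem_star T A Z a : (a \in star T A Z) = (a \in A) && (Z \subset T a).
Proof. by rewrite inE. Qed.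

Lemma star_sub T A Z : star T A Z \subset A.
Proof. by apply/subsetP => a /setIdP[]. Qed.

Lemma star0 T A : star T A set0 = A.
Proof. by apply/setP => a; rewrite inE sub0set andbT. Qed.

Lemma star_star T A S Z : star T (star T A S) Z = star T A (S :|: Z).
Proof. by apply/setP => a; rewrite !inE subUset andbA. Qed.

Lemma starS T U A B Z :
  B \subset A -> (forall a, a \in B -> U a \subset T a) -> star U B Z \subset star T A Z.
Proof.
move=> /subsetP BA UT; apply/subsetP => a; rewrite !inE => /andP[aB ZU].
by rewrite BA // (subset_trans ZU) ?UT.
Qed.

Lemma star_link T A S Z : [disjoint Z & S] -> star (link T S) A Z = star T A Z.
Proof. by move=> dZS; apply/setP => a; rewrite !inE subsetD dZS andbT. Qed.

Lemma star_link_meet T A S Z : ~~ [disjoint Z & S] -> star (link T S) A Z = set0.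
Proof. by move/negbTE=> mZS; apply/setP => a; rewrite !inE subsetD mZS !andbF. Qed.

Lemma disjoint_link T S Y a : [disjoint S & Y] -> [disjoint link T S a & Y] = [disjoint T a & Y].
Proof. by move=> dSY; rewrite [RHS](disjoint_setID _ S) (disjointWl (subsetIr _ _) dSY). Qed.

Lemma meet_sub_stars T A Y :
  [set a in A | ~~ [disjoint T a & Y]] \subset \bigcup_(y in Y) star T A [set y].
Proof.
apply/subsetP => a; rewrite inE -setI_eq0 => /andP[aA /set0Pn[y /setIP[yT yY]]].
by apply/bigcupP; exists y; rewrite // inE aA sub1set.
Qed.

Lemma spreadP T A R M :
  reflect (forall Z, #|star T A Z| * R ^ #|Z| <= M) (spread T A R M).
Proof. exact: forallP. Qed.

Lemma spread_linkP T A S R M : #|A| <= M ->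
  reflect (forall Z, Z != set0 -> [disjoint Z & S] -> #|star T A Z| * R ^ #|Z| <= M)
    (spread (link T S) A R M).
Proof.
move=> AM; apply: (iffP (spreadP _ _ _ _)) => sprA Z.
  by move=> _ dZS; rewrite -(star_link T A dZS).
have [->|Z0] := eqVneq Z set0; first by rewrite star0 cards0 muln1.
have [dZS|/star_link_meet ->] := boolP [disjoint Z & S]; last by rewrite cards0.
by rewrite star_link ?sprA.
Qed.

Lemma spread_sub T U A B R M :
  B \subset A -> (forall a, a \in B -> U a \subset T a) ->
  spread T A R M -> spread U B R M.
Proof.
move=> BA UT /spreadP sprA; apply/spreadP => Z; apply: leq_trans (sprA Z).
by rewrite leq_mul2r subset_leq_card ?orbT ?starS.
Qed.

Lemma spread_leq T A R R' M : R' <= R -> spread T A R M -> spread T A R' M.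
Proof.
move=> R'R /spreadP sprA; apply/spreadP => Z; apply: leq_trans (sprA Z).
by case: #|Z| => // z; rewrite leq_mul2l leq_exp2r ?R'R ?orbT.
Qed.

Lemma spread_dense_sub T A B R M c :
  B \subset A -> 0 < c -> M <= c * #|B| -> spread T A (c * R) M -> spread T B R #|B|.
Proof.
move=> BA c_gt0 Mc /spreadP sprA; apply/spreadP => Z.
have [->|Z0] := eqVneq Z set0; first by rewrite star0 cards0 muln1.
have [z zE] : exists z, #|Z| = z.+1 by exists #|Z|.-1; rewrite prednK ?card_gt0.
rewrite -(leq_pmul2l c_gt0); apply: leq_trans (leq_trans (sprA Z) Mc).
rewrite mulnCA leq_mul ?subset_leq_card ?starS //.
rewrite expnMn leq_mul2r; apply/orP; right.
by rewrite zE expnS leq_pmulr // expn_gt0 c_gt0.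
Qed.

Lemma spread_card_meet T A R M Y :
  spread T A R M -> #|[set a in A | ~~ [disjoint T a & Y]]| * R <= #|Y| * M.
Proof.
move=> /spreadP sprA; apply: (@leq_trans ((\sum_(y in Y) #|star T A [set y]|) * R)).
  rewrite leq_mul2r (leq_trans (subset_leq_card (meet_sub_stars T A Y))) ?orbT //.
  exact: leq_card_bigcup.
rewrite big_distrl -sum_nat_const leq_sum //= => y _.
by have := sprA [set y]; rewrite cards1 expn1.
Qed.

Lemma spread_card_avoid T A R Y :
  0 < R -> #|Y| <= R -> spread T A (2 * R) #|A| ->
  #|A| <= 2 * #|[set a in A | [disjoint T a & Y]]|.
Proof.
move=> R_gt0 YR /(spread_card_meet Y); set meets := #|_| => meets_le.
have {}meets_le : 2 * meets <= #|A|.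
  by rewrite -(leq_pmul2l R_gt0); have := leq_mul YR (leqnn #|A|); lia.
suff: #|A| = #|[set a in A | [disjoint T a & Y]]| + meets by lia.
by rewrite -(cardsID [set a | [disjoint T a & Y]] A); congr (_ + _); apply: eq_card => a;
  rewrite !inE // andbC.
Qed.

End SpreadFamilies.

Section DisjointFamilies.

Variables (X J : finType).
Implicit Type f : J -> {set X}.

Definition disjoint_family f : bool :=
  [forall i, forall j, (i != j) ==> [disjoint f i & f j]].

Lemma disjoint_familyP f :
  reflect (forall i j, i != j -> [disjoint f i & f j]) (disjoint_family f).
Proof.
apply: (iffP 'forall_forallP) => [df i j|df i j]; first exact/implyP.
exact/implyP/df.
Qed.

Lemma disjoint_family_bigcup f i :
  disjoint_family f -> [disjoint f i & \bigcup_(j | j != i) f j].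
Proof.
by move/disjoint_familyP=> df; apply: bigcup_disjoint => j ji; rewrite df // eq_sym.
Qed.

End DisjointFamilies.

Lemma disjoint_family_inj (X J K : finType) (h : K -> J) (f : J -> {set X}) :
  injective h -> disjoint_family f -> disjoint_family (f \o h).
Proof.
move=> h_inj /disjoint_familyP df; apply/disjoint_familyP => i j ij.
by apply: df; rewrite (inj_eq h_inj).
Qed.

Lemma disjoint_family_set1 (X J : finType) (h : J -> X) :
  injective h -> disjoint_family (fun j => [set h j]).
Proof.
by move=> h_inj; apply/disjoint_familyP => i j; rewrite disjoints1 inE (inj_eq h_inj).
Qed.

(** * Minimal fragments and random colourings *)

Section Fragments.

Variables (X I : finType) (T : I -> {set X}) (A : {set I}).
Implicit Types (W Z t : {set X}) (a b : I).

Definition frag_idx W a : I :=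
  [arg min_(b < a | (b \in A) && (T b \subset T a :|: W)) #|T b :\: W|].

Definition frag W a : {set X} := T (frag_idx W a) :\: W.

Definition large_frag k W : {set I} := [set a in A | k < 2 * #|frag W a|].

Definition member_within Z : {set X} :=
  if [pick b in A | T b \subset Z] is Some b then T b else set0.

Lemma frag_idxP W a : a \in A ->
  [/\ frag_idx W a \in A, T (frag_idx W a) \subset T a :|: W
    & forall b, b \in A -> T b \subset T a :|: W -> #|frag W a| <= #|T b :\: W|].
Proof.
rewrite /frag /frag_idx => aA.
case: arg_minnP => [|b /andP[bA bT] bmin]; first by rewrite aA subsetUl.
by split=> // c cA cT; apply: bmin; rewrite cA.
Qed.

Lemma frag_idx_subU W a : T (frag_idx W a) \subset frag W a :|: W.
Proof. by rewrite setUC -subDset. Qed.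

Lemma frag_sub W a : a \in A -> frag W a \subset T a :\: W.
Proof.
case/(frag_idxP W) => _; rewrite setUC -subDset => sub_a _.
by rewrite subsetD sub_a disjoints_subset subsetDr.
Qed.

Lemma frag_sub_minimal W a b :
  a \in A -> b \in A -> T b \subset W :|: frag W a -> frag W a \subset T b.
Proof.
move=> aA bA; rewrite -subDset => Tb_frag; have [_ _ minimal] := frag_idxP W aA.
suff /eqP <- : T b :\: W == frag W a by apply: subsetDl.
rewrite eqEcard Tb_frag minimal // setUC -subDset (subset_trans Tb_frag) //.
exact: subset_trans (frag_sub W aA) (subsetDl _ _).
Qed.

Lemma frag_sub_member_within W a :
  a \in A -> frag W a \subset member_within (W :|: frag W a).
Proof.
move=> aA; rewrite /member_within; case: pickP => [b /andP[]|/(_ (frag_idx W a))].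
  exact: frag_sub_minimal.
by have [-> _ _] := frag_idxP W aA; rewrite setUC frag_idx_subU.
Qed.

Lemma card_member_within k Z : (forall a, a \in A -> #|T a| <= k) -> #|member_within Z| <= k.
Proof.
by rewrite /member_within => Tk; case: pickP => [b /andP[/Tk]|]; rewrite ?cards0.
Qed.

(* [W] is recovered from [Z = W :|: t] and its fragment [t], and minimality confines [t] to
   the set [member_within Z], which depends on [Z] only. *)
Lemma sum_large_frag_at (D : {set X}) k q a : a \in A -> T a \subset D ->
  \sum_(W in powerset D | k < 2 * #|frag W a|) q ^ #|D :\: W| <=
  \sum_(Z in powerset D)
    \sum_(t in powerset (member_within Z) | (k < 2 * #|t|) && (t \subset T a))
      q ^ (#|D :\: Z| + #|t|).
Proof.
move=> aA TaD; rewrite pair_big_dep /=.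
have fragP W : frag W a \subset T a /\ [disjoint frag W a & W].
  by apply/andP; rewrite -subsetD frag_sub.
apply: (leq_sum_inj (h := fun W => (W :|: frag W a, frag W a))).
  apply: (can_in_inj (g := fun p => p.1 :\: p.2)) => W _ /=.
  by rewrite setDUl setDv setU0; apply/setDidPl; rewrite disjoint_sym; case: (fragP W).
move=> W /=; rewrite !powersetE => /andP[WD large]; have [fragT dfragW] := fragP W.
have fragD := subset_trans fragT TaD.
rewrite subUset WD fragD frag_sub_member_within // large fragT; split=> //.
rewrite -setDDl [#|_ :\: frag W a|]cardsDS ?subnK ?subset_leq_card //.
  by rewrite subsetD fragD.
by rewrite subsetD fragD.
Qed.

Lemma sum_large_frag_le (D : {set X}) k q : (forall a, a \in A -> T a \subset D) ->
  \sum_(W in powerset D) q ^ #|D :\: W| * #|large_frag k W| <=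
  \sum_(Z in powerset D) \sum_(t in powerset (member_within Z) | k < 2 * #|t|)
    q ^ #|D :\: Z| * (#|star T A t| * q ^ #|t|).
Proof.
move=> TD; apply: (@leq_trans (\sum_(a in A)
    \sum_(W in powerset D | k < 2 * #|frag W a|) q ^ #|D :\: W|)).
  rewrite (exchange_big_dep [in powerset D]) //= => [|a W _ /andP[] //].
  apply: leq_sum => W WD; rewrite mulnC -sum_nat_const eq_leq //.
  by apply: eq_bigl => a; rewrite inE WD.
apply: leq_trans; first by apply: leq_sum => a aA; apply: sum_large_frag_at (TD a aA).
rewrite exchange_big /=; apply: leq_sum => Z _.
rewrite (exchange_big_dep [pred t in powerset (member_within Z) | k < 2 * #|t|]) /=.
  apply: leq_sum => t tZ; rewrite mulnCA -expnD -sum_nat_const eq_leq //.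
  by apply: eq_bigl => a; rewrite mem_star; case/andP: tZ => -> ->.
by move=> a t _ /and3P[-> ->].
Qed.

Lemma spread_card_large_star k q R M t :
  2 ^ 7 * q <= R -> spread T A R M -> k < 2 * #|t| ->
  #|star T A t| * q ^ #|t| * 2 ^ (3 * k + 4) <= M.
Proof.
move=> qR /spreadP/(_ t) sprA kt; apply: leq_trans sprA; rewrite -mulnA leq_mul //.
apply: (@leq_trans ((2 ^ 7 * q) ^ #|t|)).
  by rewrite expnMn -expnM mulnC leq_mul2r leq_exp2l ?orbT //; lia.
by rewrite leq_exp2r //; lia.
Qed.

Lemma sum_large_frag (D : {set X}) k q R M :
  bounded_in T A D k ->
  2 ^ 7 * q <= R -> spread T A R M ->
  (\sum_(W in powerset D) q ^ #|D :\: W| * #|large_frag k W|) * 2 ^ (2 * k + 4)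
    <= M * q.+1 ^ #|D|.
Proof.
move=> TDk qR sprA; rewrite -(@leq_pmul2r (2 ^ k)) ?expn_gt0 // -mulnA -expnD.
have -> : 2 * k + 4 + k = 3 * k + 4 by lia.
apply: leq_trans (leq_mul (sum_large_frag_le _ _ _) (leqnn _)) _ => [a /TDk[] //|].
rewrite -sum_subsets_exp !(big_distrl, big_distrr) /=; apply: leq_sum => Z _.
apply: (@leq_trans (\sum_(t in powerset (member_within Z)) q ^ #|D :\: Z| * M)).
  rewrite big_distrl [leqRHS]big_mkcond big_mkcondr [leqLHS]big_mkcond /=.
  apply: leq_sum => t _; case: ifP => // _; case: ifP => // kt.
  by rewrite -mulnA leq_mul2l (spread_card_large_star qR sprA) ?orbT.
rewrite sum_nat_const card_powerset mulnC [M * _]mulnC leq_mul2l leq_exp2l //.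
by rewrite card_member_within ?orbT // => a /TDk[].
Qed.

End Fragments.

Section Thinning.

Variables (X I : finType) (T : I -> {set X}) (A : {set I}) (k M : nat).
Implicit Types (D W : {set X}) (a b : I).

Definition stalled W : bool := M < #|large_frag T A k W| * 2 ^ k.+1.

Definition thin_index W : {set I} := if stalled W then A else A :\: large_frag T A k W.

Definition thin W a : {set X} := if stalled W then T a :\: W else frag T A W a.

Definition thin_size W : nat := if stalled W then k else k./2.

Lemma thin_index_sub W : thin_index W \subset A.
Proof. by rewrite /thin_index; case: ifP => _ //; apply: subsetDl. Qed.

Lemma thin_sub W a : a \in thin_index W -> thin W a \subset T a :\: W.
Proof.
move=> /(subsetP (thin_index_sub W)) aA; rewrite /thin.
by case: ifP => _ //; apply: frag_sub.
Qed.

Lemma thin_completes W : completes T A (thin W) (thin_index W) W.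
Proof.
move=> a /(subsetP (thin_index_sub W)) aA; rewrite /thin; case: ifP => _.
  by exists a; rewrite // setUC -subDset.
by exists (frag_idx T A W a); [case: (frag_idxP T W aA) | apply: frag_idx_subU].
Qed.

Lemma spread_thin W R : spread T A R M -> spread (thin W) (thin_index W) R M.
Proof.
apply: spread_sub (thin_index_sub W) _ => a /thin_sub; rewrite subsetD.
by case/andP.
Qed.

Lemma thin_bounded D W :
  bounded_in T A D k -> bounded_in (thin W) (thin_index W) (D :\: W) (thin_size W).
Proof.
move=> TDk a a_thin; have [aD ak] := TDk a (subsetP (thin_index_sub W) a a_thin).
split; first exact: subset_trans (thin_sub a_thin) (setSD W aD).
move: a_thin; rewrite /thin /thin_index /thin_size; case: ifP => _; last first.
  by rewrite !inE => /andP[]; lia.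
by move=> _; apply: leq_trans (subset_leq_card (subsetDl _ _)) ak.
Qed.

Lemma card_thin_loss W : 0 < k -> (M - #|A|) * 2 ^ k.+1 <= M ->
  (M - #|thin_index W|) * 2 ^ (thin_size W).+1 <= M.
Proof.
move=> k_gt0 lossA; rewrite /thin_index /thin_size; case: ifPn => //; rewrite -leqNgt => few_large.
have largeA : large_frag T A k W \subset A by apply/subsetP => a /setIdP[].
have lost : (M - #|A :\: large_frag T A k W|) * 2 ^ k.+1 <= M + M.
  apply: leq_trans (leq_add lossA few_large); rewrite -mulnDl leq_mul2r cardsDS //.
  by have := subset_leq_card largeA; lia.
have : 2 ^ k./2.+1 <= 2 ^ k by rewrite leq_exp2l //; lia.
move=> /(leq_mul (leqnn (M - #|A :\: large_frag T A k W|))).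
by move: lost; rewrite expnS; lia.
Qed.

Lemma sum_stalled D q R :
  0 < k -> 0 < M -> bounded_in T A D k -> 2 ^ 7 * q <= R -> spread T A R M ->
  (\sum_(W in powerset D | stalled W) q ^ #|D :\: W|) * 16 <= q.+1 ^ #|D|.
Proof.
move=> k_gt0 M_gt0 TDk qR sprA; rewrite -(leq_pmul2l M_gt0).
apply: leq_trans (sum_large_frag TDk qR sprA); rewrite mulnA.
set bad := \sum_(W in powerset D) _.
have markov : M * (\sum_(W in powerset D | stalled W) q ^ #|D :\: W|) <= bad * 2 ^ k.+1.
  rewrite /bad big_distrr big_distrl /= [leqRHS](bigID stalled) /=.
  apply: leq_trans (leq_addr _ _); apply: leq_sum => W /andP[_ /ltnW large].
  by rewrite -mulnA mulnC leq_mul2l large orbT.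
apply: leq_trans (leq_mul markov (leqnn 16)) _; rewrite -mulnA leq_mul2l -[16]/(2 ^ 4).
by rewrite -expnD leq_exp2l ?orbT //; lia.
Qed.

Lemma sum_stall_weight D q j :
  (\sum_(W in powerset D | stalled W) q ^ #|D :\: W|) * 16 <= q.+1 ^ #|D| ->
  (\sum_(W in powerset D) 8 ^ (if stalled W then j.+1 else j) * q ^ #|D :\: W|) * 4
    <= 8 ^ j.+1 * q.+1 ^ #|D|.
Proof.
set lost := \sum_(_ in _ | _) _.
pose kept := \sum_(W in powerset D | ~~ stalled W) q ^ #|D :\: W|.
have <- : lost + kept = q.+1 ^ #|D| by rewrite -sum_subsets_exp [RHS](bigID stalled).
have -> : \sum_(W in powerset D) 8 ^ (if stalled W then j.+1 else j) * q ^ #|D :\: W|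
    = 8 ^ j.+1 * lost + 8 ^ j * kept.
  rewrite (bigID stalled) /= !big_distrr; congr (_ + _); apply: eq_bigr => W.
    by case/andP=> _ ->.
  by case/andP=> _ /negbTE->.
move=> rare; have : 8 * lost + kept <= 2 * (lost + kept) by lia.
by move/(leq_mul (leqnn (8 ^ j))); rewrite expnS; lia.
Qed.

End Thinning.

Section Colourings.

Variables (X I K : finType) (c0 : K).
Implicit Types (D W : {set X}) (C : {set K}) (A : {set I}) (T : I -> {set X}).
Implicit Types (f : {ffun X -> K}) (cs : seq K).

Definition colour_fail D C A T cs : {set {ffun X -> K}} :=
  [set f in pffun_on c0 (mem D) (mem C) |
    [forall a in A, ~~ (T a \subset [set x | f x \in cs])]].

Definition erase W f : {ffun X -> K} := [ffun x => if x \in W then c0 else f x].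

Lemma card_colour_fail_le D C A T cs : #|colour_fail D C A T cs| <= #|C| ^ #|D|.
Proof.
rewrite -(card_pffun_on c0 (mem D) (mem C)).
by apply/subset_leq_card/subsetP => f /setIdP[].
Qed.

Lemma colour_fail_eq0 D C A T cs a : a \in A -> T a = set0 -> colour_fail D C A T cs = set0.
Proof.
move=> aA Ta0; apply/setP => f; rewrite !inE; apply/negP => /andP[_ /forall_inP/(_ a aA)].
by rewrite Ta0 sub0set.
Qed.

Lemma erase_inj D W (c : K) :
  {in [set f : {ffun X -> K} | [set x in D | f x == c] == W] &, injective (erase W)}.
Proof.
move=> f g; rewrite !inE => /eqP fW /eqP gW /ffunP eq_fg; apply/ffunP => x.
have := eq_fg x; rewrite !ffunE; case: ifP => // xW _.
by move: xW (xW); rewrite -{1}fW -gW !inE => /andP[_ /eqP ->] /andP[_ /eqP ->].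
Qed.

Lemma erase_pffun_on D C W (c : K) f :
  f \in pffun_on c0 (mem D) (mem C) -> [set x in D | f x == c] = W ->
  erase W f \in pffun_on c0 (mem (D :\: W)) (mem (C :\ c)).
Proof.
move=> /pffun_onP[/subsetP fD fC] fW; apply/pffun_onP; split.
  apply/subsetP => x; rewrite !inE ffunE; case: ifP => [_|_ fx]; first by rewrite eqxx.
  by have := fD x; rewrite inE; apply.
move=> y /imageP[x] /setDP[xD xW] ->; rewrite ffunE (negbTE xW) !inE fC ?andbT.
  by apply: contra xW => fx; rewrite -fW inE xD.
by apply/imageP; exists x.
Qed.

Lemma erase_colour_fail D C A A' T T' (c : K) cs W f :
  completes T A T' A' W -> f \in colour_fail D C A T (c :: cs) ->
  [set x in D | f x == c] = W ->
  erase W f \in colour_fail (D :\: W) (C :\ c) A' T' cs.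
Proof.
move=> lift /setIdP[fDC /forall_inP fail] fW; rewrite inE erase_pffun_on //=.
apply/forall_inP => a /lift[b bA /subsetP Tb]; apply: contra (fail b bA) => /subsetP T'a.
apply/subsetP => x /Tb; rewrite !inE; case: (boolP (x \in W)) => [xW _|xW].
  by move: xW; rewrite -fW inE => /andP[_ ->].
by rewrite orbF => /T'a; rewrite inE ffunE (negbTE xW) => ->; rewrite orbT.
Qed.

Lemma card_colour_fail_cons D C A T (c : K) cs
    (A' : {set X} -> {set I}) (T' : {set X} -> I -> {set X}) :
  (forall W, completes T A (T' W) (A' W) W) ->
  #|colour_fail D C A T (c :: cs)| <=
  \sum_(W in powerset D) #|colour_fail (D :\: W) (C :\ c) (A' W) (T' W) cs|.
Proof.
move=> lift; pose class (f : {ffun X -> K}) := [set x in D | f x == c].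
rewrite -sum1_card (partition_big class [in powerset D]) /=; last first.
  by move=> f _; rewrite powersetE; apply/subsetP => x /setIdP[].
apply: leq_sum => W _; rewrite sum1dep_card -(@card_in_imset _ _ (erase W)).
  apply/subset_leq_card/subsetP => _ /imsetP[f /setIdP[ffail /eqP fW] ->].
  exact: erase_colour_fail (lift W) ffail fW.
move=> f g /setIdP[_ fW] /setIdP[_ gW].
by apply: (@erase_inj D W c); rewrite inE.
Qed.

(* With the colour [c] spent on one round of thinning, the failure probability [p L j], for
   [L] colours left and sets of size less than [2 ^ j], satisfies
   [p L.+1 j.+1 <= p L j + p L j.+1 / 16], which is solved by [8 ^ j / 4 ^ L]. *)
Lemma colour_fail_bound R M cs j k D C A T :
  uniq cs -> {subset cs <= C} -> 2 ^ 7 * #|C| <= R -> 0 < M -> k < 2 ^ j ->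
  bounded_in T A D k -> spread T A R M -> (M - #|A|) * 2 ^ k.+1 <= M ->
  #|colour_fail D C A T cs| * 4 ^ size cs <= 8 ^ j * #|C| ^ #|D|.
Proof.
elim: cs j k D C A T => [|c cs IHcs] j k D C A T.
  move=> *; rewrite muln1 (leq_trans (card_colour_fail_le _ _ _ _ _)) //.
  by rewrite leq_pmull // expn_gt0.
move=> /= /andP[c_cs uniq_cs] csC CR M_gt0 kj TDk sprA lossA.
have [k0|k_gt0] := posnP k.
  have /card_gt0P[a aA] : 0 < #|A| by move: lossA; rewrite k0; lia.
  have [_] := TDk a aA; rewrite k0 leqn0 cards_eq0 => /eqP Ta0.
  by rewrite (colour_fail_eq0 _ _ _ aA Ta0) cards0.
case: j kj => [|j] kj; first by move: kj; rewrite expn0; lia.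
have cC : c \in C by rewrite csC // mem_head.
have cardC : #|C| = #|C :\ c|.+1 by rewrite (cardsD1 c C) cC.
have qR : 2 ^ 7 * #|C :\ c| <= R by lia.
have round W : #|colour_fail (D :\: W) (C :\ c) (thin_index T A k M W) (thin T A k M W) cs|
    * 4 ^ size cs
    <= 8 ^ (if stalled T A k M W then j.+1 else j) * #|C :\ c| ^ #|D :\: W|.
  apply: (IHcs _ (thin_size T A k M W)) => //.
  - move=> d dcs; rewrite !inE csC ?andbT ?inE ?dcs ?orbT //.
    by apply: contraNneq c_cs => <-.
  - by rewrite /thin_size; case: ifP => _ //; move: kj; rewrite expnS; lia.
  - exact: thin_bounded.
  - exact: spread_thin.
  - exact: card_thin_loss.
rewrite cardC expnSr mulnA.
apply: leq_trans (sum_stall_weight j (sum_stalled k_gt0 M_gt0 TDk qR sprA)).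
have fail_le := card_colour_fail_cons D C c cs (@thin_completes _ _ T A k M).
rewrite leq_mul2r; apply: leq_trans (leq_mul fail_le (leqnn _)) _.
by rewrite big_distrl leq_sum.
Qed.

End Colourings.

Lemma colour_fail_rare (X I K : finType) (c0 : K) (T : I -> {set X}) (A : {set I})
    (cs : seq K) R l :
  uniq cs -> size cs = 2 * l -> 2 ^ 7 * #|K| <= R -> A != set0 ->
  (forall a, a \in A -> #|T a| < 2 ^ l) -> spread T A R #|A| ->
  #|colour_fail c0 setT setT A T cs| * 2 ^ l <= #|{ffun X -> K}|.
Proof.
move=> uniq_cs size_cs KR A_neq0 Tl sprA.
have := @colour_fail_bound _ _ _ c0 R #|A| cs l (2 ^ l).-1 setT setT A T uniq_cs.
rewrite !cardsT -card_ffun size_cs card_gt0 A_neq0 subnn prednK ?expn_gt0 // => bound.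
have {bound} : #|colour_fail c0 setT setT A T cs| * 4 ^ (2 * l) <= 8 ^ l * #|{ffun X -> K}|.
  apply: bound => // [c|a /Tl Ta]; rewrite ?inE ?subsetT //.
  by rewrite -ltnS prednK ?expn_gt0.
by rewrite expnM (_ : 4 ^ 2 = 8 * 2) // expnMn mulnCA leq_pmul2l // expn_gt0.
Qed.

Lemma spread_disjoint (X I J : finType) (T : J -> I -> {set X}) (A : J -> {set I}) R l :
  2 ^ 8 * (#|J| * l) <= R -> #|J| < 2 ^ l -> (forall j, A j != set0) ->
  (forall j a, a \in A j -> #|T j a| < 2 ^ l) -> (forall j, spread (T j) (A j) R #|A j|) ->
  exists2 a : J -> I, forall j, a j \in A j & disjoint_family (fun j => T j (a j)).
Proof.
move=> lR Jl A_neq0 Tl sprA.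
have [j0 _|J0] := pickP (@predT J); last first.
  have /fin_all_exists[a aA] j : exists a, a \in A j by apply/set0Pn.
  by exists a => //; apply/disjoint_familyP => j; have := J0 j.
have J_gt0 : 0 < #|J| by apply/card_gt0P; exists j0.
have l2_gt0 : 0 < 2 * l.
  by rewrite muln_gt0 /= lt0n; apply: contraTneq Jl => ->; rewrite -leqNgt.
pose c0 := (j0, Ordinal l2_gt0); pose cs (j : J) := [seq (j, r) | r <- enum 'I_(2 * l)].
pose fail j := colour_fail c0 setT setT (A j) (T j) (cs j).
have fail_rare j : #|fail j| * 2 ^ l <= #|{ffun X -> J * 'I_(2 * l)}|.
  apply: (@colour_fail_rare _ _ _ _ _ _ _ R) => //.
  - by rewrite map_inj_uniq ?enum_uniq // => r r' [].
  - by rewrite size_map size_enum_ord.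
  - by rewrite card_prod card_ord (leq_trans _ lR) // [in leqRHS]expnS; lia.
  - exact: Tl.
have [|f f_ok] := @exists_notin_bigcup _ _ fail.
  rewrite -(ltn_pmul2r (_ : 0 < 2 ^ l)) ?expn_gt0 // big_distrl /=.
  apply: leq_ltn_trans; first by apply: leq_sum => j _; apply: fail_rare.
  rewrite sum_nat_const mulnC ltn_pmul2l //.
  by apply/card_gt0P; exists [ffun=> c0].
have /fin_all_exists[a aP] j : exists a, (a \in A j) && (T j a \subset [set x | f x \in cs j]).
  have := f_ok j; rewrite inE (_ : f \in _); last first.
    by apply/pffun_onP; split=> [|c]; rewrite ?in_setT //; apply/subsetP => x; rewrite in_setT.
  by rewrite negb_forall => /existsP[a]; rewrite negb_imply negbK; exists a.
exists a => [j|]; first by case/andP: (aP j).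
apply/disjoint_familyP => i j neq_ij; rewrite -setI_eq0; apply: contraNT neq_ij.
case/andP: (aP i) (aP j) => _ /subsetP fi /andP[_ /subsetP fj].
case/set0Pn => x /setIP[/fi + /fj]; rewrite !inE => /mapP[r _ ->] /mapP[r' _ [-> _]].
exact: eqxx.
Qed.

(* Half of each family avoids all the other kernels, by spreadness, and stays spread. *)
Lemma spread_link_disjoint (X I J : finType) (T : I -> {set X}) (A : J -> {set I})
    (S : J -> {set X}) R l :
  2 ^ 8 * (#|J| * l) <= R -> 0 < R -> #|J| < 2 ^ l ->
  (forall j a, a \in A j -> #|T a| < 2 ^ l) -> (forall j, #|S j| <= l) ->
  disjoint_family S -> (forall j, A j != set0) ->
  (forall j, spread (link T (S j)) (A j) (2 * R) #|A j|) ->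
  exists2 a : J -> I, forall j, a j \in A j & disjoint_family (T \o a).
Proof.
move=> lR R_gt0 Jl Tl Sl disjS A_neq0 sprA.
pose others j := \bigcup_(i | i != j) S i.
pose B j := [set a in A j | [disjoint T a & others j]].
have card_others j : #|others j| <= R.
  apply: leq_trans (leq_card_bigcup_const (fun i _ => Sl i)) _; apply: leq_trans lR.
  by rewrite (leq_trans (leq_mul (max_card _) (leqnn l))) // leq_pmull // expn_gt0.
have half j : #|A j| <= 2 * #|B j|.
  rewrite (leq_trans (spread_card_avoid R_gt0 (card_others j) (sprA j))) // leq_mul2l /=.
  rewrite subset_leq_card //; apply/subsetP => a; rewrite !inE.
  by rewrite disjoint_link ?disjoint_family_bigcup.
have BA j : B j \subset A j by apply/subsetP => a /setIdP[].
have [|j a /setIdP[aA _]|j|a aB disj_link] :=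
    @spread_disjoint _ _ _ (fun j => link T (S j)) B R l lR Jl.
- by move=> j; move: (half j) (A_neq0 j); rewrite -!card_gt0; lia.
- exact: leq_ltn_trans (subset_leq_card (subsetDl _ _)) (Tl j a aA).
- exact: spread_dense_sub (BA j) _ (half j) (sprA j).
have avoid i j : i != j -> [disjoint S j & T (a i)].
  have /setIdP[_ /bigcup_disjointP avoid_i] := aB i.
  by rewrite eq_sym disjoint_sym; apply: avoid_i.
exists a => [j|]; first exact: subsetP (BA j) _ (aB j).
apply/disjoint_familyP => i j neq_ij /=.
rewrite -(disjoint_link T _ (avoid j i _)) 1?eq_sym // disjoint_sym.
rewrite -(disjoint_link T _ (disjointWr (subsetDl _ _) (avoid i j neq_ij))) disjoint_sym.
by move/disjoint_familyP: disj_link => ->.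
Qed.

(** * Peeling families without large matchings *)

Lemma heavy_star_exists (X I : finType) (T : I -> {set X}) (A : {set I}) R q c :
  R ^ q * c < #|A| ->
  exists S : {set X}, [/\ #|S| <= q, R ^ (q - #|S|) * c < #|star T A S|
    & forall U : {set X}, S \proper U -> #|U| <= q -> #|star T A U| <= R ^ (q - #|U|) * c].
Proof.
pose heavy (S : {set X}) := (#|S| <= q) && (R ^ (q - #|S|) * c < #|star T A S|).
move=> A_large; have heavy0 : heavy set0 by rewrite /heavy cards0 subn0 star0.
case: (@arg_maxnP _ set0 heavy (fun S => #|S|) heavy0) => S /andP[Sq S_large] S_max.
exists S; split=> // U SU Uq; rewrite leqNgt; apply/negP => U_large.
by have := S_max U; rewrite /heavy Uq U_large /= leqNgt proper_card // => /(_ isT).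
Qed.

Section Matchings.

Variable X : finType.
Implicit Types (K : {set {set X}}) (P S Y : {set X}).

Definition matching_free k K : Prop :=
  forall f : 'I_k -> {set X}, (forall i, f i \in K) -> ~~ disjoint_family f.

Definition minorizes K K' : Prop := forall S, S \in K' -> exists2 P, P \in K & P \subset S.

Definition flexible K P b : Prop :=
  forall Y, [disjoint P & Y] -> #|Y| <= b -> exists2 S, S \in K & [disjoint S & Y].

Definition layer K m : {set {set X}} := [set S in K | #|S| == m].

Lemma matching_free_sub k K K' : K' \subset K -> matching_free k K -> matching_free k K'.
Proof. by move=> /subsetP K'K freeK f fK'; apply: freeK => i; apply: K'K. Qed.

Lemma matching_free_card k K (J : finType) (f : J -> {set X}) :
  matching_free k K -> (forall j, f j \in K) -> disjoint_family f -> #|J| < k.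
Proof.
move=> freeK fK disjf; rewrite ltnNge; apply/negP => kJ.
have widen_inj : injective (widen_ord kJ).
  by move=> i j /(congr1 val) /= eq_ij; apply: val_inj.
have := freeK (f \o (enum_val \o widen_ord kJ)) (fun=> fK _).
by rewrite disjoint_family_inj //; apply: inj_comp enum_val_inj widen_inj.
Qed.

Lemma matching_free_set0 k K : matching_free k K -> set0 \notin K.
Proof.
move=> freeK; apply/negP => K0; have /negP[] := freeK (fun=> set0) (fun=> K0).
by apply/disjoint_familyP => i j _; rewrite -setI_eq0 setI0.
Qed.

Lemma disjoint_family_update (J : finType) (f : J -> {set X}) i S :
  disjoint_family f -> [disjoint S & \bigcup_(j | j != i) f j] ->
  disjoint_family (fun j => if j == i then S else f j).
Proof.
move=> /disjoint_familyP disjf /bigcup_disjointP disjS; apply/disjoint_familyP => j j'.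
case: (eqVneq j i) => [->|ji]; case: (eqVneq j' i) => [_|j'i] //.
- by move=> _; apply: disjS.
- by move=> _; rewrite disjoint_sym; apply: disjS.
- exact: disjf.
Qed.

(* Occurrences of [P] in a matching are replaced one by one with members of [K]. *)
Lemma matching_freeU1 u m K P :
  (forall S, S \in K -> #|S| <= m) -> #|P| <= m -> flexible K P (u * m) ->
  matching_free u.+1 K -> matching_free u.+1 (P |: K).
Proof.
move=> Km Pm flexP freeK f fPK; apply/negP.
have [b] := ubnP #|[set i | f i \notin K]|; elim: b f fPK => // b IHb f fPK f_b disjf.
have [/existsP[i fiK]|] := boolP [exists i, f i \notin K]; last first.
  move/existsPn=> allK; have fK i : f i \in K by have := allK i; rewrite negbK.
  by have := freeK f fK; rewrite disjf.
have fiP : f i = P by have := fPK i; rewrite in_setU1 (negbTE fiK) orbF => /eqP.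
have [||S SK disjS] := flexP (\bigcup_(j | j != i) f j).
- by rewrite -fiP disjoint_family_bigcup.
- rewrite (leq_trans (leq_card_bigcup_const (c := m) _)) //; last by rewrite cardC1 card_ord.
  by move=> j _; have := fPK j; rewrite in_setU1 => /orP[/eqP-> | /Km].
apply: (IHb _ _ _ (disjoint_family_update disjf disjS)) => [j|].
  by case: eqP; rewrite !inE ?SK ?orbT // => _; have := fPK j; rewrite !inE.
rewrite -ltnS (leq_trans _ f_b) // ltnS; apply: proper_card; apply/properP; split.
  by apply/subsetP => j; rewrite !inE; case: eqP; rewrite ?SK.
by exists i; rewrite !inE ?eqxx ?SK.
Qed.

Lemma uniform_kernel_exists K m b :
  (forall S, S \in K -> #|S| = m) -> b ^ m < #|K| ->
  exists2 P : {set X}, #|P| < m & star id K P != set0 /\ flexible (star id K P) P b.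
Proof.
move=> Km; rewrite -[b ^ m]muln1 => /(heavy_star_exists id)[P [Pm P_large P_max]].
have {}Pm : #|P| < m.
  rewrite ltn_neqAle Pm andbT; apply: contraL P_large => /eqP eqPm.
  rewrite -leqNgt eqPm subnn -(cards1 P) mul1n; apply/subset_leq_card/subsetP => S /setIdP[SK PS].
  by rewrite inE eq_sym eqEcard PS (Km S SK) eqPm leqnn.
exists P => //; split=> [|Y disjPY Yb]; first by rewrite -card_gt0 (leq_ltn_trans _ P_large).
apply/exists_inP; apply: contraTT P_large => /exists_inPn hit; rewrite -leqNgt muln1.
have P_meet : star id K P \subset [set S in star id K P | ~~ [disjoint S & Y]].
  by apply/subsetP => S SP; rewrite inE SP hit.
apply: leq_trans (subset_leq_card (subset_trans P_meet (meet_sub_stars _ _ _))) _.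
apply: (@leq_trans (#|Y| * b ^ (m - #|P|.+1))).
  apply: leq_card_bigcup_const => y yY; rewrite star_star setUC -[leqRHS]muln1.
  have yP : y \notin P by rewrite (disjointFl disjPY).
  have card_yP : #|y |: P| = #|P|.+1 by rewrite cardsU1 yP.
  by rewrite -card_yP P_max ?card_yP // properEcard subsetU1 card_yP ltnSn.
by rewrite (_ : m - #|P| = (m - #|P|.+1).+1) ?expnS ?leq_mul2r ?Yb ?orbT //; lia.
Qed.

Lemma peel_kernel u m K :
  (forall S, S \in K -> #|S| <= m) -> matching_free u.+1 K -> (u * m) ^ m < #|layer K m| ->
  exists K', [/\ forall S, S \in K' -> #|S| <= m, matching_free u.+1 K', minorizes K' K
    & #|layer K' m| < #|layer K m|].
Proof.
move=> Km freeK layer_large.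
have [|P Pm [star_neq0 flexP]] := uniform_kernel_exists _ layer_large.
  by move=> S /setIdP[_ /eqP].
exists (P |: (K :\: star id (layer K m) P)); split.
- by move=> S; rewrite in_setU1 in_setD => /orP[/eqP->|/andP[_ /Km]] //; apply: ltnW.
- apply: (@matching_free_sub _ (P |: K)); first by rewrite setUS ?subsetDl.
  apply: (@matching_freeU1 _ m) => // [|Y disjPY Ym]; first exact: ltnW.
  have [S /setIdP[/setIdP[SK _] _] disjSY] := flexP Y disjPY Ym.
  by exists S.
- move=> S SK; have [/setIdP[_ PS]|SP] := boolP (S \in star id (layer K m) P).
    by exists P; rewrite ?setU11.
  by exists S; rewrite // in_setU1 in_setD SP SK orbT.
apply: proper_card; apply/properP; split.
  apply/subsetP => S /setIdP[]; rewrite in_setU1 in_setD => /orP[/eqP->|/andP[_ SK]] Sm.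
    by rewrite (ltn_eqF Pm) in Sm.
  by rewrite inE SK.
have /set0Pn[S SP] := star_neq0; exists S; first by case/setIdP: SP.
rewrite [S \in layer _ _]inE in_setU1 in_setD SP orbF; apply/negP => /andP[/eqP eqSP /eqP eqSm].
by rewrite -eqSP eqSm ltnn in Pm.
Qed.

Lemma peel_layer u m K :
  (forall S, S \in K -> #|S| <= m) -> matching_free u.+1 K ->
  exists K', [/\ forall S, S \in K' -> #|S| <= m, matching_free u.+1 K', minorizes K' K
    & #|layer K' m| <= (u * m) ^ m].
Proof.
have [b] := ubnP #|layer K m|; elim: b K => // b IHb K layer_b Km freeK.
have [layer_small|layer_large] := leqP #|layer K m| ((u * m) ^ m).
  by exists K; split=> // S SK; exists S.
have [K1 [K1m freeK1 K1K lt_layer]] := peel_kernel Km freeK layer_large.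
have [|//|//|K2 [K2m freeK2 K2K1 layer_small]] := IHb K1.
  exact: leq_trans lt_layer layer_b.
exists K2; split=> // S /K1K[P /K2K1[Q QK2 QP] PS].
by exists Q => //; apply: subset_trans PS.
Qed.

End Matchings.

Section Coverings.

Variables (X I : finType) (T : I -> {set X}) (A : {set I}).
Implicit Type K : {set {set X}}.

Definition covered K : {set I} := [set a in A | [exists S in K, S \subset T a]].

Lemma covered_sub_stars K : covered K \subset \bigcup_(S in K) star T A S.
Proof.
apply/subsetP => a /setIdP[aA /exists_inP[S SK ST]].
by apply/bigcupP; exists S; rewrite // inE aA.
Qed.

Lemma covered_minorizes K K' : minorizes K K' -> covered K' \subset covered K.
Proof.
move=> KK'; apply/subsetP => a /setIdP[aA /exists_inP[S /KK'[P PK PS] ST]].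
by rewrite inE aA; apply/exists_inP; exists P => //; apply: subset_trans ST.
Qed.

Lemma covered_layer K m : (forall S, S \in K -> #|S| <= m.+1) ->
  covered K \subset
    covered [set S in K | #|S| <= m] :|: \bigcup_(S in layer K m.+1) star T A S.
Proof.
move=> Km; apply/subsetP => a /setIdP[aA /exists_inP[S SK ST]]; rewrite in_setU.
have := Km S SK; rewrite leq_eqVlt => /orP[Sm|Sm]; apply/orP; [right|left].
  by apply/bigcupP; exists S; rewrite inE ?SK ?aA.
by rewrite inE aA; apply/exists_inP; exists S; rewrite // inE SK.
Qed.

Lemma card_covered_le (c : nat -> nat) u m K :
  (forall S : {set X}, #|star T A S| <= c #|S|) ->
  (forall S, S \in K -> #|S| <= m) -> matching_free u.+1 K ->
  #|covered K| <= \sum_(1 <= j < m.+1) (u * j) ^ j * c j.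
Proof.
move=> Ac; elim: m K => [|m IHm] K Km freeK.
  rewrite big_geq // leqn0 cards_eq0 -subset0 (subset_trans (covered_sub_stars K)) //.
  apply/bigcupsP => S SK; have := Km S SK; rewrite leqn0 cards_eq0 => /eqP S0.
  by have := matching_free_set0 freeK; rewrite -S0 SK.
have [K' [K'm freeK' /covered_minorizes coverK layer_le]] := peel_layer Km freeK.
rewrite big_nat_recr //= (leq_trans (subset_leq_card (subset_trans coverK (covered_layer K'm)))) //.
apply: leq_trans (leq_card_setU _ _) _; apply: leq_add.
  apply: IHm => [S /setIdP[] //|]; apply: matching_free_sub freeK'.
  by apply/subsetP => S /setIdP[].
apply: leq_trans (leq_card_bigcup_const (c := c m.+1) _) _ => [S /setIdP[_ /eqP <-] //|].
by rewrite leq_mul2r layer_le orbT.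
Qed.

End Coverings.

(** * Permutations as sets of pairs *)

Section SpreadKernels.

Variables (X I : finType) (T : I -> {set X}).
Implicit Types (A G : {set I}) (S : {set X}).

Definition spread_kernels A R l : {set {set X}} :=
  [set S : {set X} | (#|S| <= l) && [exists G : {set I},
    [&& G != set0, G \subset star T A S & spread (link T S) G R #|G|]]].

Lemma spread_kernelsP A R l S :
  reflect (#|S| <= l /\ exists G : {set I},
             [/\ G != set0, G \subset star T A S & spread (link T S) G R #|G|])
    (S \in spread_kernels A R l).
Proof.
rewrite inE; apply: (iffP andP) => -[Sl].
  by case/existsP=> G /and3P[? ? ?]; split=> //; exists G.
by case=> G [? ? ?]; split=> //; apply/existsP; exists G; apply/and3P.
Qed.

Lemma spread_kernels_meet A R l S : S \in spread_kernels A R l -> star T A S != set0.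
Proof.
case/spread_kernelsP=> _ [G [G_neq0 GA _]].
by apply: contraNneq G_neq0 => A0; rewrite -subset0 -A0.
Qed.

Lemma spread_kernelsS A A' R l :
  A' \subset A -> spread_kernels A' R l \subset spread_kernels A R l.
Proof.
move=> A'A; apply/subsetP => S /spread_kernelsP[Sl [G [G_neq0 GA sprG]]].
apply/spread_kernelsP; split=> //; exists G; split=> //.
exact: subset_trans GA (starS _ A'A (fun a _ => subxx _)).
Qed.

Lemma spread_kernels_disjoint A (J : finType) (S : J -> {set X}) R l :
  (forall a, a \in A -> #|T a| < 2 ^ l) -> 2 ^ 9 * (#|J| * l) <= R -> 1 < R ->
  #|J| < 2 ^ l -> (forall j, S j \in spread_kernels A R l) -> disjoint_family S ->
  exists2 a : J -> I, forall j, a j \in A & disjoint_family (T \o a).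
Proof.
move=> Tl lR R_gt1 Jl SK disjS.
have Sl j : #|S j| <= l by case/spread_kernelsP: (SK j).
have [G GP] := fin_all_exists (fun j => (elimT (spread_kernelsP _ _ _ _) (SK j)).2).
have GA j a : a \in G j -> a \in A.
  by have [_ /subset_trans/(_ (star_sub _ _ _))/subsetP + _] := GP j; apply.
have [||j a /GA/Tl //|j|j|a aG disj_a] :=
    @spread_link_disjoint _ _ _ T G S R./2 l _ _ Jl _ Sl disjS.
- by move: lR; rewrite [2 ^ 9]expnS; lia.
- by lia.
- by have [] := GP j.
- by have [_ _] := GP j; apply: spread_leq; lia.
by exists a => // j; apply: GA (aG j).
Qed.

End SpreadKernels.

Section PermutationGraphs.

Variable n : nat.
Implicit Types (F : {set {perm 'I_n}}) (S Z : {set 'I_n * 'I_n}) (U : {set 'I_n}).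
Implicit Types (s t : {perm 'I_n}).

Definition graph s : {set 'I_n * 'I_n} := [set p | s p.1 == p.2].

Definition agree U s : {set {perm 'I_n}} := [set t : {perm 'I_n} | [forall i in U, t i == s i]].

Lemma mem_graph s p : (p \in graph s) = (s p.1 == p.2).
Proof. by rewrite inE. Qed.

Lemma card_graph s : #|graph s| = n.
Proof.
rewrite -[RHS]card_ord -cardsT -(@card_imset _ _ (fun i => (i, s i))); last by move=> i j [].
apply: eq_card => -[x y]; rewrite !inE /=; apply/eqP/imsetP => [<-|[i _ [-> ->]] //].
by exists x.
Qed.

Lemma disjoint_graph s t : [disjoint graph s & graph t] = ~~ intersecting s t.
Proof.
rewrite -setI_eq0 /intersecting; apply/eqP/existsPn => [/setP st i|st].
  by have := st (i, s i); rewrite !inE eqxx /= eq_sym => ->.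
apply/setP => -[i y]; rewrite !inE /=; apply/negP => /andP[/eqP <- /eqP e].
by have := st i; rewrite e eqxx.
Qed.

Lemma card_agree U s : #|agree U s| = (n - #|U|)`!.
Proof.
have -> : n - #|U| = #|~: U| by rewrite [RHS]cardsCs setCK card_ord.
rewrite -card_perm -[RHS]cardsE -[RHS](@card_imset _ _ (fun u => (u * s)%g)); last exact: mulIg.
apply: eq_card => t; rewrite !inE; apply/forall_inP/imsetP => [agree_t|[u]].
  exists (t * s^-1)%g; last by rewrite mulgKV.
  rewrite inE; apply/subsetP => x; rewrite !inE permM; apply: contra => /agree_t/eqP ->.
  by rewrite permK.
rewrite inE => /subsetP uU -> x xU; rewrite permM.
by have [-> //|/uU] := eqVneq (u x) x; rewrite inE xU.
Qed.

Lemma card_star_graph F S : #|star graph F S| <= (n - #|S|)`!.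
Proof.
have [->|/set0Pn[s /setIdP[_ /subsetP Ss]]] := eqVneq (star graph F S) set0.
  by rewrite cards0.
have -> : #|S| = #|[set p.1 | p in S]|.
  rewrite card_in_imset // => -[x y] [x' y'] /Ss + /Ss; rewrite !inE /=.
  by move=> /eqP <- /eqP <- ->.
rewrite -(card_agree _ s); apply/subset_leq_card/subsetP => t /setIdP[_ /subsetP St].
rewrite inE; apply/forall_inP => _ /imsetP[[x y] xyS ->] /=.
by have := St _ xyS; have := Ss _ xyS; rewrite !inE /= => /eqP -> /eqP ->.
Qed.

Lemma star_graph_eq0 F S : n < #|S| -> star graph F S = set0.
Proof.
move=> nS; apply/eqP; rewrite -subset0; apply/subsetP => s /setIdP[_ /subset_leq_card].
by rewrite card_graph leqNgt nS.
Qed.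

Lemma card_star_graph_scaled F S R q :
  q <= #|S| -> 4 * R <= n - q -> #|star graph F S| * R ^ (#|S| - q) <= (n - q)`!.
Proof.
move=> qS Rn; have [nS|Sn] := ltnP n #|S|; first by rewrite star_graph_eq0 ?cards0.
apply: leq_trans (leq_mul (card_star_graph F S) (leqnn _)) _; rewrite mulnC.
have -> : n - #|S| = n - q - (#|S| - q) by lia.
by apply: expn_fact_le => //; lia.
Qed.

Lemma spread_star_graph F S R :
  4 * R <= n - #|S| -> spread (link graph S) (star graph F S) R (n - #|S|)`!.
Proof.
move=> Rn; apply/spread_linkP; first exact: card_star_graph.
move=> Z _ dZS; rewrite star_star.
have := @card_star_graph_scaled F (S :|: Z) R #|S| (subset_leq_card (subsetUl _ _)) Rn.
by rewrite cardsU disjoint_setI0 1?disjoint_sym // cards0 subn0 addKn.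
Qed.

Lemma spread_star_exists F R q :
  4 * R <= n - q -> R ^ q * (n - q)`! < #|F| ->
  exists S, [/\ #|S| <= q, star graph F S != set0
    & spread (link graph S) (star graph F S) R #|star graph F S|].
Proof.
move=> Rn /(heavy_star_exists graph)[S [Sq S_large S_max]]; exists S; split=> //.
  by rewrite -card_gt0 (leq_ltn_trans _ S_large).
apply/spread_linkP => // Z Z0 dZS; rewrite star_star.
have cSZ : #|S :|: Z| = #|S| + #|Z|.
  by rewrite cardsU disjoint_setI0 1?disjoint_sym // cards0 subn0.
apply: leq_trans (ltnW S_large); have [SZq|qSZ] := leqP #|S :|: Z| q.
  have SZ : S \proper S :|: Z.
    by rewrite properEcard subsetUl cSZ -addn1 leq_add2l card_gt0 Z0.
  apply: leq_trans (leq_mul (S_max _ SZ SZq) (leqnn _)) _; rewrite mulnAC -expnD.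
  by rewrite (_ : q - #|S :|: Z| + #|Z| = q - #|S|) //; lia.
have -> : #|Z| = (q - #|S|) + (#|S :|: Z| - q) by lia.
by rewrite expnD mulnCA leq_mul2l card_star_graph_scaled ?orbT // ltnW.
Qed.

Lemma card_uncovered F R l :
  4 * R <= n - l ->
  #|F :\: covered graph F (spread_kernels graph F R l)| <= R ^ l * (n - l)`!.
Proof.
move=> Rn; rewrite leqNgt; apply/negP => /(spread_star_exists Rn)[S [Sl S_neq0 sprS]].
have /set0Pn[s /setIdP[/setDP[sF uncovered] Ss]] := S_neq0.
case/negP: uncovered; rewrite inE sF; apply/exists_inP; exists S => //.
apply/spread_kernelsP; split=> //.
by eexists; split; [exact: S_neq0 | apply: starS; rewrite ?subsetDl | exact: sprS].
Qed.

Lemma leq_nu (J : finType) F (a : J -> {perm 'I_n}) :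
  0 < n -> (forall j, a j \in F) -> disjoint_family (graph \o a) -> #|J| <= nu F.
Proof.
move=> n_gt0 aF /disjoint_familyP disj_a.
have a_inj : injective a.
  move=> i j eq_a; apply/eqP; apply: contraT => /disj_a /=; rewrite eq_a -setI_eq0 setIid.
  by rewrite -cards_eq0 card_graph eqn0Ngt n_gt0.
rewrite -cardsT -(card_imset _ a_inj); apply: (@bigmax_sup _ (a @: setT)) => //.
apply/andP; split; first by apply/subsetP => s /imsetP[j _ ->]; apply: aF.
apply/forall_inP => s /imsetP[i _ ->]; apply/forall_inP => t /imsetP[j _ ->].
by apply/implyP => neq_a; rewrite -disjoint_graph disj_a //; apply: contraNneq neq_a => ->.
Qed.

Lemma nu_disjoint_lt F t :
  0 < n -> t \in F -> nu [set s in F | [disjoint graph s & graph t]] < nu F.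
Proof.
move=> n_gt0 tF; set F' := [set s in F | _].
have [|G /andP[/subsetP GF' /forall_inP indepG] nuF'] := @eq_bigmax_cond _
    [pred G : {set {perm 'I_n}} | (G \subset F') && pairwise_nonintersecting G]
    (fun G : {set {perm 'I_n}} => #|G|).
  apply/card_gt0P; exists set0; rewrite inE sub0set.
  by apply/forall_inP => s; rewrite inE.
have tG s : s \in G -> ~~ intersecting s t.
  by move=> /GF' /setIdP[_]; rewrite disjoint_graph.
have t_notin : t \notin G.
  apply/negP => /tG; rewrite -disjoint_graph -setI_eq0 setIid -cards_eq0 card_graph.
  by rewrite eqn0Ngt n_gt0.
apply: leq_trans (_ : #|t |: G| <= _); first by rewrite [nu F']nuF' cardsU1 t_notin.
apply: (@bigmax_sup _ (t |: G)) => //; apply/andP; split.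
  by apply/subsetP => s /setU1P[-> // | /GF' /setIdP[]].
apply/forall_inP => s1 s1G; apply/forall_inP => s2 s2G; apply/implyP => neq12.
case/setU1P: s1G s2G neq12 => [->|s1G] /setU1P[->|s2G]; first by rewrite eqxx.
- by rewrite -disjoint_graph disjoint_sym disjoint_graph => _; apply: tG.
- by move=> _; apply: tG.
- by move=> neq12; have /forall_inP/(_ s2 s2G)/implyP := indepG s1 s1G; apply.
Qed.

End PermutationGraphs.

Arguments graph {n} s.

(** * Permutations avoiding forbidden positions *)

Section ForbiddenPositions.

Variables (n : nat) (U : {set 'I_n}) (s0 : {perm 'I_n}) (Q : 'I_n -> {set 'I_n}) (b : nat).
Implicit Types (t : {perm 'I_n}) (i k y : 'I_n).

Definition hits t : {set 'I_n} := [set i | t i \in Q i].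

Definition hit_level j : {set {perm 'I_n}} := [set t in agree U s0 | #|hits t| == j].

Hypothesis row_le : forall i, #|Q i| <= b.
Hypothesis col_le : forall y, #|[set i | y \in Q i]| <= b.
Hypothesis U_hit_free : forall i, i \in U -> s0 i \notin Q i.

Definition blocked t i : {set 'I_n} :=
  U :|: hits t :|: [set k | t k \in Q i] :|: [set k | t i \in Q k].

Lemma card_perm_preim_row t i : #|[set k | t k \in Q i]| <= b.
Proof.
have -> : [set k | t k \in Q i] = t @^-1: Q i by apply/setP => k; rewrite !inE.
by rewrite card_preimset ?row_le //; apply: perm_inj.
Qed.

Lemma card_blocked t i : #|blocked t i| <= #|U| + #|hits t| + b + b.
Proof.
apply: leq_trans (leq_card_setU _ _) _; apply: leq_add (col_le _).
apply: leq_trans (leq_card_setU _ _) _; apply: leq_add (card_perm_preim_row _ _).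
exact: leq_card_setU.
Qed.

Lemma agree_hit_notin t i : t \in agree U s0 -> i \in hits t -> i \notin U.
Proof.
rewrite !inE => /forall_inP agree_t hit_i; apply/negP => iU.
by have := U_hit_free iU; rewrite -(eqP (agree_t i iU)) hit_i.
Qed.

Lemma hits_tperm t i k : i \in hits t -> k \notin blocked t i ->
  hits (tperm i k * t)%g = hits t :\ i.
Proof.
rewrite !inE !negb_or => hit_i /andP[/andP[/andP[_ no_hit_k] kQi] iQk].
have ki : k != i by apply: contraNneq no_hit_k => ->.
apply/setP => x; rewrite !inE permM; case: tpermP => [->|->|/eqP xi /eqP xk].
- by rewrite eqxx (negbTE kQi).
- by rewrite ki (negbTE iQk) (negbTE no_hit_k).
- by rewrite xi.
Qed.

Lemma switch_hit_level t i k j :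
  t \in hit_level j.+1 -> i \in hits t -> k \notin blocked t i ->
  (tperm i k * t)%g \in hit_level j.
Proof.
move=> /setIdP[agree_t /eqP hits_t] hit_i k_free; rewrite inE hits_tperm //.
have := cardsD1 i (hits t); rewrite hits_t hit_i add1n => -[<-]; rewrite eqxx andbT.
have iU := agree_hit_notin agree_t hit_i.
have kU : k \notin U by apply: contra k_free; rewrite !inE => ->.
rewrite inE; apply/forall_inP => x xU; move: agree_t; rewrite inE => /forall_inP/(_ x xU).
by rewrite permM tpermD //; [apply: contraNneq iU | apply: contraNneq kU] => ->.
Qed.

(* Switching a hit row [i] with an unblocked row [k] destroys exactly one hit, and [k] then
   takes its value in [Q i]. *)
Lemma card_hit_level_switch j :
  #|hit_level j.+1| * (j.+1 * (n - (#|U| + j.+1 + b + b))) <= #|hit_level j| * (n * b).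
Proof.
apply: (@leq_trans (\sum_(t in hit_level j.+1) \sum_(i in hits t) #|~: blocked t i|)).
  rewrite -sum_nat_const; apply: leq_sum => t /setIdP[_ /eqP hits_t].
  rewrite -[X in X * _]hits_t -sum_nat_const; apply: leq_sum => i _.
  by rewrite [leqRHS]cardsCs setCK card_ord leq_sub2l // -hits_t card_blocked.
apply: (@leq_trans (\sum_(t in hit_level j) \sum_i #|[set k | t k \in Q i]|)); last first.
  rewrite -sum_nat_const; apply: leq_sum => t _.
  rewrite -[X in X * b]card_ord -sum_nat_const; apply: leq_sum => i _.
  exact: card_perm_preim_row.
under [leqLHS]eq_bigr do under eq_bigr do rewrite -sum1_card.
under [leqRHS]eq_bigr do under eq_bigr do rewrite -sum1_card.
rewrite !pair_big_dep /=.
pose switch (p : {perm 'I_n} * 'I_n * 'I_n) := ((tperm p.1.2 p.2 * p.1.1)%g, p.1.2, p.2).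
apply: (leq_sum_inj (h := switch)) => [[[t i] k] [[t' i'] k'] _ _ /= []|[[t i] k]] /=.
  by move=> eq_t eq_i eq_k; move: eq_t; rewrite eq_i eq_k => /mulgI ->.
rewrite in_setC => /andP[/andP[t_level hit_i] k_free].
by rewrite switch_hit_level // inE permM tpermR; move: hit_i; rewrite inE => ->.
Qed.

Lemma card_agree_at i y :
  i \notin U -> #|[set t in agree U s0 | t i == y]| <= (n - #|U|.+1)`!.
Proof.
move=> iU; have [->|/set0Pn[s]] := eqVneq [set t in agree U s0 | t i == y] set0.
  by rewrite cards0.
rewrite !inE => /andP[/forall_inP agree_s /eqP s_i].
have -> : #|U|.+1 = #|i |: U| by rewrite cardsU1 iU.
rewrite -(card_agree _ s); apply/subset_leq_card/subsetP => t; rewrite !inE.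
case/andP=> /forall_inP agree_t /eqP t_i; apply/forall_inP => x /setU1P[->|xU].
  by rewrite t_i s_i.
by rewrite (eqP (agree_t x xU)) (eqP (agree_s x xU)).
Qed.

Lemma card_agree_hit i :
  i \notin U -> #|[set t in agree U s0 | i \in hits t]| <= b * (n - #|U|.+1)`!.
Proof.
move=> iU; apply: (@leq_trans (#|Q i| * (n - #|U|.+1)`!)); last by rewrite leq_mul2r row_le orbT.
apply: leq_trans (leq_card_bigcup_const (fun y _ => card_agree_at y iU)).
apply/subset_leq_card/subsetP => t /setIdP[agree_t]; rewrite inE => hit_i.
by apply/bigcupP; exists (t i); rewrite // inE agree_t eqxx.
Qed.

Lemma sum_hits : \sum_(t in agree U s0) #|hits t| <= b * (n - #|U|)`!.
Proof.
apply: (@leq_trans (\sum_(i in ~: U) #|[set t in agree U s0 | i \in hits t]|)).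
  under eq_bigr do rewrite -sum1_card; under [leqRHS]eq_bigr do rewrite -sum1_card.
  rewrite (exchange_big_dep [in ~: U]) /= => [|t i agree_t hit_i]; last first.
    by rewrite inE (agree_hit_notin agree_t).
  by apply: leq_sum => i _; rewrite eq_leq //; apply: eq_bigl => t; rewrite [RHS]inE.
apply: (@leq_trans (\sum_(i in ~: U) b * (n - #|U|.+1)`!)).
  by apply: leq_sum => i; rewrite inE; apply: card_agree_hit.
rewrite sum_nat_const [#|~: U|]cardsCs setCK card_ord subnS mulnCA leq_mul2l.
by case: (n - #|U|) => [|m]; rewrite ?mul0n ?factS ?leqnn orbT.
Qed.

Lemma card_agree_markov m :
  m.+1 * (n - #|U|)`! <= m.+1 * (\sum_(j < m.+1) #|hit_level j|) + b * (n - #|U|)`!.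
Proof.
apply: leq_trans _ (leq_add (leqnn _) sum_hits).
have card_level (j : 'I_m.+1) : #|hit_level j| = \sum_(t in agree U s0) (#|hits t| == j).
  by rewrite -[LHS]sum1dep_card big_mkcondr; apply: eq_bigr => t _; case: eqP.
have -> : \sum_(j < m.+1) #|hit_level j| = \sum_(t in agree U s0) (#|hits t| <= m).
  rewrite (eq_bigr _ (fun j _ => card_level j)).
  rewrite exchange_big; apply: eq_bigr => t _ /=; have [hits_le|hits_gt] := leqP #|hits t| m.
    rewrite (bigD1 (Ordinal (hits_le : _ < m.+1))) //= eqxx big1 // => j.
    by rewrite eq_sym -val_eqE => /negbTE /= ->.
  by rewrite big1 // => j _; rewrite gtn_eqF // (leq_trans (ltn_ord j)).
rewrite -(card_agree U s0) mulnC -sum_nat_const big_distrr -big_split.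
by apply: leq_sum => t _ /=; case: leqP; lia.
Qed.

End ForbiddenPositions.

Lemma fact_le_hit_free n (U : {set 'I_n}) (s0 : {perm 'I_n}) (Q : 'I_n -> {set 'I_n}) :
  2 ^ 10 <= n -> #|U| <= 2 ->
  (forall i, #|Q i| <= 2) -> (forall y, #|[set i | y \in Q i]| <= 2) ->
  (forall i, i \in U -> s0 i \notin Q i) ->
  (n - #|U|)`! <= 16 * #|hit_level U s0 Q 0|.
Proof.
move=> n_large U2 row2 col2 U_free.
pose N j := #|hit_level U s0 Q j|.
have switch j : N j.+1 * (j.+1 * (n - (#|U| + j.+1 + 2 + 2))) <= N j * (n * 2).
  exact: card_hit_level_switch row2 col2 U_free j.
have markov : 3 * (n - #|U|)`! <= 3 * (N 0 + N 1 + N 2) + 2 * (n - #|U|)`!.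
  by have := card_agree_markov row2 U_free 2; rewrite !big_ord_recr big_ord0.
have n_ge : 1000 <= n by apply: leq_trans n_large.
have ratio : 100 * n <= 101 * (n - 8) by lia.
have n8_gt0 : 0 < n - 8 by lia.
have switch10 : N 1 * (n - 8) <= 2 * n * N 0.
  rewrite [leqRHS]mulnC [2 * n]mulnC; apply: leq_trans (switch 0).
  by rewrite mul1n leq_mul2l leq_sub2l ?orbT //; lia.
have switch21 : N 2 * (2 * (n - 8)) <= 2 * n * N 1.
  rewrite [leqRHS]mulnC [2 * n]mulnC; apply: leq_trans (switch 1).
  by rewrite !leq_mul2l leq_sub2l ?orbT //; lia.
have N1_le : 100 * N 1 <= 202 * N 0.
  by rewrite -(leq_pmul2r n8_gt0); have := leq_mul ratio (leqnn (2 * N 0)); lia.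
have N2_le : 100 * N 2 <= 101 * N 1.
  by rewrite -(leq_pmul2r n8_gt0); have := leq_mul ratio (leqnn (N 1)); lia.
rewrite -/(N 0); lia.
Qed.

Section DerangementStars.

Variable n : nat.
Implicit Types (x y : 'I_n) (t : {perm 'I_n}).

Lemma perm_two_points x x' y y' :
  x != x' -> y != y' -> exists g : {perm 'I_n}, g x = y /\ g x' = y'.
Proof.
move=> neq_x neq_y; exists (tperm x y * tperm (tperm x y x') y')%g; rewrite !permM tpermL.
split; last by rewrite tpermL.
have x'_y : tperm x y x' != y by rewrite -{2}(tpermL x y) (inj_eq perm_inj) eq_sym.
by apply: tpermD; rewrite // eq_sym.
Qed.

Lemma Dpair_star x y : Dpair x y = star graph (Dn n) [set (x, y)].
Proof. by apply/setP => s; rewrite !inE sub1set inE. Qed.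

Lemma Dpair_diag x : Dpair x x = set0.
Proof. by apply/setP => s; rewrite !inE; apply/andP => -[/forallP/(_ x)/negP]. Qed.

Lemma leq_card_Dpair x y x' y' : x != y -> x' != y' -> #|Dpair x y| <= #|Dpair x' y'|.
Proof.
move=> xy xy'; have [g [gx gy]] := perm_two_points xy xy'.
rewrite -(@card_imset _ _ (fun s => (s ^ g)%g)); last exact: conjg_inj.
apply/subset_leq_card/subsetP => t /imsetP[s]; rewrite inE => /andP[/forallP ds /eqP sx] ->.
rewrite inE -gx permJ sx gy eqxx andbT; apply/forallP => i.
by rewrite -[i](permKV g) permJ (inj_eq perm_inj).
Qed.

Lemma card_Dpair x y : x != y -> #|Dpair x y| = d_n1 n.
Proof.
move=> xy; have n_ge2 : 1 < n.
  by rewrite -[n]card_ord; apply/card_gt1P; exists x, y.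
pose o0 := Ordinal (ltnW n_ge2); pose o1 := Ordinal n_ge2.
have -> : d_n1 n = #|Dpair o0 o1|.
  apply: eq_card => s; rewrite !inE; congr (_ && _).
  apply/existsP/eqP => [[i /andP[/eqP i0 /eqP s1]]|s0]; last by exists o0; rewrite s0.
  by apply: val_inj; rewrite (_ : o0 = i) //; apply: val_inj.
by apply/eqP; rewrite eqn_leq !leq_card_Dpair.
Qed.

Lemma card_Dpair_avoid x y t : 2 ^ 10 <= n -> x != y -> t x != y ->
  n.-1`! <= 16 * #|[set s in Dpair x y | [disjoint graph s & graph t]]|.
Proof.
move=> n_large xy txy.
have := @fact_le_hit_free n [set x] (tperm x y) (fun i => [set i; t i]) n_large.
rewrite cards1 subn1 => /(_ isT) hit_free_large.
apply: leq_trans (hit_free_large _ _ _) _ => [i|z|i /set1P->|].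
- by rewrite cards2; case: (_ != _).
- apply: (@leq_trans #|[set z; (t^-1)%g z]|); last by rewrite cards2; case: (_ != _).
  apply/subset_leq_card/subsetP => i; rewrite !inE => /orP[/eqP->|/eqP->]; first by rewrite eqxx.
  by rewrite permK eqxx orbT.
- by rewrite tpermL !inE negb_or eq_sym xy eq_sym.
rewrite leq_mul2l; apply/subset_leq_card/subsetP => s; rewrite !inE.
move=> /andP[/forall_inP/(_ x (set11 x)) s_x /eqP/cards0_eq/setP no_hit].
have avoid i : (s i != i) && (s i != t i) by have := no_hit i; rewrite !inE -negb_or => ->.
rewrite tpermL in s_x; rewrite s_x andbT disjoint_graph; apply/andP; split.
  by apply/forallP => i; case/andP: (avoid i).
by rewrite negb_exists; apply/forallP => i; case/andP: (avoid i).
Qed.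

Lemma Dpair_meet x y x' y' :
  2 ^ 10 <= n -> x != y -> x' != y' -> x != x' -> y != y' ->
  ~~ [disjoint Dpair x y & Dpair x' y'].
Proof.
move=> n_large xy xy' neq_x neq_y; have [g [gx gy]] := perm_two_points neq_x neq_y.
have := @fact_le_hit_free n [set x; x'] g (fun i => [set i]) n_large.
rewrite cards2 neq_x => /(_ isT) hit_free_large.
have [s] : exists s, s \in hit_level [set x; x'] g (fun i => [set i]) 0.
  apply/card_gt0P; rewrite -(@ltn_pmul2l 16) // muln0.
  apply: leq_trans (fact_gt0 _) (hit_free_large _ _ _) => [i|z|i /set2P[]->].
  - by rewrite cards1.
  - by rewrite (_ : [set _ | _] = [set z]) ?cards1 //; apply/setP => i; rewrite !inE eq_sym.
  - by rewrite gx inE eq_sym.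
  - by rewrite gy inE eq_sym.
rewrite !inE => /andP[/forall_inP agree_s /eqP/cards0_eq/setP no_hit].
have ds : derangement s by apply/forallP => i; have := no_hit i; rewrite !inE => ->.
rewrite -setI_eq0; apply/set0Pn; exists s.
by rewrite !inE ds -gx -gy !agree_s // !inE eqxx ?orbT.
Qed.

Lemma fact_le_d_n1 : 2 ^ 10 <= n -> n.-1`! <= 16 * d_n1 n.
Proof.
move=> n_large; have n_ge2 : 1 < n by apply: leq_trans n_large.
pose o0 := Ordinal (ltnW n_ge2); pose o1 := Ordinal n_ge2.
apply: leq_trans (card_Dpair_avoid n_large (_ : o0 != o1) (t := 1%g) _) _; rewrite ?perm1 //.
rewrite leq_mul2l -(card_Dpair (_ : o0 != o1)) //; apply/subset_leq_card/subsetP => s.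
by case/setIdP.
Qed.

Lemma d_n1_gt0 : 2 ^ 10 <= n -> 0 < d_n1 n.
Proof. by move=> /fact_le_d_n1; have := fact_gt0 n.-1; lia. Qed.

End DerangementStars.

(** * Kernels and dense pairs *)

Lemma kernel_term_le n u j : 1 < j -> 2 ^ 15 * (u * j) < n ->
  2 ^ 11 * ((u * j) ^ j * (n - j)`!) * 2 ^ j.-1 <= u * n.-1`!.
Proof.
case: j => [|[|i]] //= _ uj_n.
have [->|u_gt0] := posnP u; first by rewrite mul0n exp0n // mul0n muln0.
have fact_le : (2 ^ 13 * (u * i.+2)) ^ i.+1 * (n - i.+2)`! <= n.-1`!.
  have uj_n' : 4 * (2 ^ 13 * (u * i.+2)) <= n.-1.
    by rewrite mulnA -[4]/(2 ^ 2) -expnD; lia.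
  have -> : n - i.+2 = n.-1 - i.+1 by lia.
  by apply: expn_fact_le uj_n'; have := leq_pmull i.+2 u_gt0; have : 0 < 2 ^ 13 by []; nia.
have const_le : 2 ^ 11 * i.+2 * 2 ^ i.+1 <= (2 ^ 13) ^ i.+1.
  have lt_exp : i.+2 <= 2 ^ i.+1 by apply: ltn_expl.
  apply: leq_trans (leq_mul (leq_mul (leqnn _) lt_exp) (leqnn _)) _.
  by rewrite -!expnD -expnM leq_exp2l //; lia.
rewrite [(u * i.+2) ^ _]expnS; apply: leq_trans (leq_mul (leqnn u) fact_le).
rewrite [in leqRHS]expnMn; have := leq_mul const_le (leqnn (u * (u * i.+2) ^ i.+1 * (n - i.+2)`!)).
by move: (2 ^ 11) (2 ^ i.+1) ((2 ^ 13) ^ i.+1) ((u * i.+2) ^ i.+1) (n - i.+2)`! => *; lia.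
Qed.

Lemma kernel_tail_le n u l : 0 < l -> 2 ^ 15 * (u * l) < n ->
  2 ^ 11 * (\sum_(2 <= j < l.+1) (u * j) ^ j * (n - j)`!) <= u * n.-1`!.
Proof.
case: l => // m _ ul_n; rewrite big_distrr /=; apply: sum_geometric_le => j /andP[j_gt1 jm].
apply: (kernel_term_le j_gt1); apply: leq_ltn_trans ul_n.
by rewrite !leq_mul2l -ltnS jm !orbT.
Qed.

Lemma kernel_rest_le n l R : 4 * (16 * R) <= n -> l <= n -> 0 < n < 2 ^ l ->
  8 ^ l * (R ^ l * (n - l)`!) <= n.-1`!.
Proof.
move=> Rn ln /andP[n_gt0 nl]; have := expn_fact_le ln Rn.
rewrite expnMn -{2}(prednK n_gt0) factS prednK // -[16]/(2 * 8) expnMn => fact_le.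
rewrite -(@leq_pmul2l (2 ^ l)) ?expn_gt0 // !mulnA; apply: leq_trans fact_le _.
by rewrite leq_mul2r ltnW ?orbT.
Qed.

Lemma singleton_spread_kernel n (F : {set {perm 'I_n}}) e c R l :
  0 < l -> 0 < c -> 4 * (c * R) <= n.-1 -> n.-1`! <= c * #|star graph F [set e]| ->
  [set e] \in spread_kernels graph F R l.
Proof.
move=> l_gt0 c_gt0 cR_n star_large; apply/spread_kernelsP; rewrite cards1; split=> //.
exists (star graph F [set e]); split=> //.
  by rewrite -card_gt0; have := leq_trans (fact_gt0 _) star_large; rewrite muln_gt0 => /andP[].
apply: (spread_dense_sub _ c_gt0 star_large) => //.
by have := @spread_star_graph n F [set e] (c * R); rewrite cards1 subn1; apply.
Qed.

Section DensePairs.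

Variables (n : nat) (F : {set {perm 'I_n}}).

Definition dense_pairs : {set 'I_n * 'I_n} :=
  [set e | 63 * d_n1 n <= 64 * #|star graph F [set e]|].

Definition residual : {set {perm 'I_n}} := [set s in F | [disjoint dense_pairs & graph s]].

Lemma sub_residual_cover :
  F \subset residual :|: \bigcup_(e in dense_pairs) star graph F [set e].
Proof.
apply/subsetP => s sF; rewrite in_setU [s \in residual]inE sF /=.
have [//|] := boolP [disjoint _ & _]; rewrite -setI_eq0 => /set0Pn[e /setIP[eE es]].
by apply/bigcupP; exists e; rewrite // inE sF sub1set.
Qed.

Lemma residual_kernel_avoids R l S e :
  S \in spread_kernels graph residual R l -> e \in dense_pairs -> e \notin S.
Proof.
case/spread_kernels_meet/set0Pn=> s /setIdP[/setIdP[_ s_avoids] /subsetP Ss] eE.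
by apply/negP => /Ss; rewrite (disjointFr s_avoids eE).
Qed.

Lemma card_star_residual_le S :
  #|star graph residual S| <= if #|S| == 1 then (63 * d_n1 n) %/ 64 else (n - #|S|)`!.
Proof.
case: ifP => [/cards1P[e ->]|_]; last exact: card_star_graph.
have [eE|eE] := boolP (e \in dense_pairs).
  rewrite (_ : star _ _ _ = set0) ?cards0 //; apply/setP => s; rewrite !inE sub1set.
  by apply/negP => /andP[/andP[_ /disjointFr/(_ eE) ->]].
rewrite leq_divRL // mulnC; move: eE; rewrite inE -ltnNge => /ltnW; apply: leq_trans.
by rewrite leq_mul2l subset_leq_card //= starS //; apply/subsetP => s /setIdP[].
Qed.

Hypothesis n_large : 2 ^ 10 <= n.

Lemma fact_le_card_dense_star e :
  e \in dense_pairs -> n.-1`! <= 24 * #|star graph F [set e]|.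
Proof. by have := fact_le_d_n1 n_large; rewrite inE; lia. Qed.

Hypothesis F_derangements : F \subset Dn n.

Lemma star_sub_Dpair x y : star graph F [set (x, y)] \subset Dpair x y.
Proof. by rewrite Dpair_star starS. Qed.

Lemma dense_pair_offdiag x y : (x, y) \in dense_pairs -> x != y.
Proof.
rewrite inE; apply: contraTneq => ->; have := star_sub_Dpair y y.
by rewrite Dpair_diag subset0 => /eqP->; rewrite cards0; have := d_n1_gt0 n_large; lia.
Qed.

Lemma card_dense_star_le e : e \in dense_pairs -> #|star graph F [set e]| <= d_n1 n.
Proof.
case: e => x y /dense_pair_offdiag/card_Dpair <-.
exact: subset_leq_card (star_sub_Dpair _ _).
Qed.

Lemma card_dense_cover_le :
  #|\bigcup_(e in dense_pairs) star graph F [set e]| <= #|dense_pairs| * d_n1 n.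
Proof. exact: leq_card_bigcup_const card_dense_star_le. Qed.

(* At least [n.-1`! / 16] derangements through [e] avoid [t], and at most one derangement in
   64 through [e] is missing from [F]. *)
Lemma fact_le_card_dense_avoid e (t : {perm 'I_n}) : e \in dense_pairs -> e \notin graph t ->
  n.-1`! <= 24 * #|star graph [set s in F | [disjoint graph s & graph t]] [set e]|.
Proof.
case: e => x y eE; rewrite mem_graph /= => t_xy; have xy := dense_pair_offdiag eE.
set Ft := [set s in F | _].
have avoid_le : #|[set s in Dpair x y | [disjoint graph s & graph t]]| <=
    #|star graph Ft [set (x, y)]| + #|Dpair x y :\: star graph F [set (x, y)]|.
  apply: leq_trans (leq_card_setU _ _); apply/subset_leq_card/subsetP => s.
  move=> /setIdP[sD dst]; rewrite in_setU in_setD sD andbT !mem_star [s \in Ft]inE dst andbT.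
  exact: orbN.
rewrite cardsDS ?star_sub_Dpair // (card_Dpair xy) in avoid_le.
have d_le : d_n1 n <= n.-1`!.
  by rewrite -(card_Dpair xy) Dpair_star -subn1 -(cards1 (x, y)) card_star_graph.
move: eE avoid_le d_le (card_dense_star_le eE) (card_Dpair_avoid n_large xy t_xy).
rewrite inE; set present := #|star _ F _|; set avoiding := #|[set _ in Dpair _ _ | _]|.
by set both := #|star _ Ft _|; lia.
Qed.

End DensePairs.

Definition collinear (A B : finType) (E : {set A * B}) : Prop :=
  {in E &, forall e e', e.1 = e'.1 \/ e.2 = e'.2}.

Lemma collinear_line (A B : finType) (a0 : A) (E : {set A * B}) :
  collinear E ->
  (exists a (Y : {set B}), E = [set (a, b) | b in Y])
  \/ (exists b (X : {set A}), E = [set (a, b) | a in X]).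
Proof.
move=> col.
have [->|/set0Pn[[a b] abE]] := eqVneq E set0.
  by left; exists a0, set0; rewrite imset0.
have [/exists_inP[e1 e1E ne]|/exists_inPn row] := boolP [exists e in E, e.1 != a].
  right; exists b, [set x | (x, b) \in E].
  have col_b e : e \in E -> e.2 = b.
    move=> eE; have /= eq1b : e1.2 = b.
      by have [eq1|] := col _ _ e1E abE; first by rewrite eq1 eqxx in ne.
    have [eq_e|] := col _ _ eE e1E; last by rewrite eq1b.
    by have [eq_ea|//] := col _ _ eE abE; rewrite -eq_e eq_ea eqxx in ne.
  apply/setP => -[x y]; apply/idP/imsetP => [xyE|[x']]; last by rewrite inE => ? [-> ->].
  by exists x; rewrite ?inE -(col_b _ xyE).
left; exists a, [set y | (a, y) \in E].
apply/setP => -[x y]; apply/idP/imsetP => [xyE|[y']]; last by rewrite inE => ? [-> ->].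
by have /negPn/eqP /= <- := row _ xyE; exists y; rewrite ?inE.
Qed.

Section SmallMatchingNumber.

Variables (n s l R : nat).
Hypotheses (n_lt_exp : n < 2 ^ l) (R_ge : 2 ^ 9 * (s * l) <= R) (R_lt_n : 96 * R < n).
Hypothesis s_gt0 : 0 < s.

Let l_gt0 : 0 < l.
Proof. by case: (l) n_lt_exp R_lt_n => //; rewrite expn0; lia. Qed.

Let s_l_le_R : 512 * s <= R /\ 512 * l <= R.
Proof.
by rewrite -[512]/(2 ^ 9); split; apply: leq_trans R_ge; rewrite leq_mul2l ?leq_pmulr ?leq_pmull.
Qed.

Let n_large : 2 ^ 10 <= n.
Proof. by have [s_le _] := s_l_le_R; rewrite (_ : 2 ^ 10 = 1024) //; lia. Qed.

Let n_gt0 : 0 < n.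
Proof. exact: leq_trans n_large. Qed.

Let l_ge4 : 4 <= l.
Proof.
rewrite leqNgt; apply/negP => l_lt4; have := leq_trans n_large (ltnW n_lt_exp).
by rewrite leq_exp2l //; lia.
Qed.

Lemma spread_kernels_matching_free (F : {set {perm 'I_n}}) k :
  nu F < k -> k <= s -> matching_free k (spread_kernels graph F R l).
Proof.
move=> nuFk k_s f fK; apply/negP => disj_f; have [s_le _] := s_l_le_R.
have [||||a aF disj_a] := @spread_kernels_disjoint _ _ graph F _ f R l _ _ _ _ fK disj_f.
- by move=> t _; rewrite card_graph.
- by rewrite card_ord (leq_trans _ R_ge) // leq_mul2l leq_mul2r k_s !orbT.
- by lia.
- by rewrite card_ord (leq_ltn_trans _ n_lt_exp) //; lia.
by have := leq_nu n_gt0 aF disj_a; rewrite card_ord leqNgt nuFk.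
Qed.

Section Families.

Variable F : {set {perm 'I_n}}.
Hypotheses (F_derangements : F \subset Dn n) (nuF : nu F < s).

Local Notation E := (dense_pairs F).
Local Notation residual_covered :=
  (covered graph (residual F) (spread_kernels graph (residual F) R l)).

Let R_le_n : 4 * (24 * R) <= n.-1.
Proof. by lia. Qed.

Lemma dense_pair_kernel e : e \in E -> [set e] \in spread_kernels graph F R l.
Proof.
move=> eE; apply: (singleton_spread_kernel l_gt0 _ R_le_n) => //.
exact: (fact_le_card_dense_star n_large eE).
Qed.

Lemma card_dense_pairs_lt : #|E| < s.
Proof.
have disjE : disjoint_family (fun e : {e | e \in E} => [set val e]).
  exact: (disjoint_family_set1 val_inj).
have := matching_free_card (spread_kernels_matching_free nuF (leqnn s)) _ disjE.
by rewrite card_sig; apply=> e; apply: dense_pair_kernel (valP e).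
Qed.

Lemma residual_kernels_matching_free u :
  u + #|E| = s -> matching_free u (spread_kernels graph (residual F) R l).
Proof.
move=> uE f fK; apply/negP => /disjoint_familyP disj_f.
pose g (j : 'I_u + {e | e \in E}) := match j with inl i => f i | inr e => [set val e] end.
have gK j : g j \in spread_kernels graph F R l.
  case: j => [i|e]; last exact: (dense_pair_kernel (valP e)).
  apply: subsetP (fK i); apply: spread_kernelsS; apply/subsetP => t.
  by case/setIdP.
have disj_g : disjoint_family g.
  apply/disjoint_familyP => -[i|[e eE]] [j|[e' eE']] /= ij.
  - by apply: disj_f; apply: contraNneq ij => ->.
  - by rewrite disjoint_sym disjoints1 (residual_kernel_avoids (fK i)).
  - by rewrite disjoints1 (residual_kernel_avoids (fK j)).
  - rewrite disjoints1 inE; apply: contraNneq ij => eq_e; apply/eqP; congr inr.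
    exact: val_inj.
have := matching_free_card (spread_kernels_matching_free nuF (leqnn s)) gK disj_g.
by rewrite card_sum card_ord card_sig uE ltnn.
Qed.

Lemma card_covered_residual_le u : u.+1 + #|E| = s ->
  128 * #|residual_covered| <= 127 * (u * d_n1 n).
Proof.
move=> uE; pose weight j := if j == 1 then (63 * d_n1 n) %/ 64 else (n - j)`!.
have weight1 : 64 * weight 1 <= 63 * d_n1 n by rewrite mulnC leq_divM.
have tail_le : 2 ^ 11 * (\sum_(2 <= j < l.+1) (u * j) ^ j * (n - j)`!) <= u * n.-1`!.
  have u_le : 2 ^ 9 * (u * l) <= R by apply: leq_trans R_ge; rewrite leq_mul2l leq_mul2r -uE; lia.
  by apply: (kernel_tail_le l_gt0); rewrite (expnD 2 6 9) -mulnA (_ : 2 ^ 6 = 64) //; lia.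
have kernel_size S : S \in spread_kernels graph (residual F) R l -> #|S| <= l.
  by case/spread_kernelsP.
have cov_le : #|residual_covered| <= u * weight 1 + \sum_(2 <= j < l.+1) (u * j) ^ j * (n - j)`!.
  have := card_covered_le (c := weight) (card_star_residual_le F) kernel_size
    (residual_kernels_matching_free uE).
  rewrite big_ltn ?ltnS ?l_gt0 // expn1 muln1.
  by rewrite (eq_big_nat _ _ (F2 := fun j => (u * j) ^ j * (n - j)`!)) // => j /andP[j2 _];
    rewrite /weight gtn_eqF.
move: (leq_mul (leqnn u) weight1) (leq_mul (leqnn u) (fact_le_d_n1 n_large)).
by move: tail_le; rewrite (_ : 2 ^ 11 = 2048) //; lia.
Qed.

Lemma card_uncovered_residual_le :
  256 * #|residual F :\: residual_covered| <= d_n1 n.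
Proof.
have [_ l_le] := s_l_le_R; have l4 := l_ge4.
have uncovered := @card_uncovered n (residual F) R l.
have rest : 8 ^ l * (R ^ l * (n - l)`!) <= n.-1`!.
  by apply: kernel_rest_le; rewrite ?n_lt_exp ?andbT; lia.
rewrite -(@leq_pmul2l 16) // (leq_trans _ (fact_le_d_n1 n_large)) //.
apply: leq_trans rest; rewrite mulnA leq_mul ?uncovered //; last by lia.
by rewrite -[16]/(2 ^ 4) -[256]/(2 ^ 8) -[8]/(2 ^ 3) -expnD -expnM leq_exp2l //; lia.
Qed.

Lemma card_residual_lt u : u.+1 + #|E| = s -> 0 < u -> #|residual F| < u * d_n1 n.
Proof.
move=> uE u_gt0; have card_cov := card_covered_residual_le uE.
have card_uncov := card_uncovered_residual_le.
suff: #|residual_covered| + #|residual F :\: residual_covered| < u * d_n1 n.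
  rewrite -[#|residual F|](cardsID residual_covered) (setIidPr _) //.
  by apply/subsetP => t /setIdP[].
by have := leq_pmull (d_n1 n) u_gt0; have := d_n1_gt0 n_large; lia.
Qed.

Lemma residual_eq0 : #|E|.+1 = s -> residual F = set0.
Proof.
move=> Es; apply/eqP; rewrite -subset0; apply/subsetP => t /setIdP[tF t_avoids].
have lt_nu := nu_disjoint_lt n_gt0 tF; set Ft := [set s in F | _] in lt_nu.
have nuFt : nu Ft < #|E| by rewrite -ltnS Es (leq_ltn_trans lt_nu).
have freeFt : matching_free #|E| (spread_kernels graph Ft R l).
  by apply: spread_kernels_matching_free nuFt _; rewrite -Es leqnSn.
have disjE : disjoint_family (fun e : {e | e \in E} => [set val e]).
  exact: (disjoint_family_set1 val_inj).
suff kernelE (e : {e | e \in E}) : [set val e] \in spread_kernels graph Ft R l.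
  by have := matching_free_card freeFt kernelE disjE; rewrite card_sig ltnn.
apply: (singleton_spread_kernel l_gt0 _ R_le_n) => //.
apply: (fact_le_card_dense_avoid n_large F_derangements (valP e)).
by rewrite (disjointFr t_avoids (valP e)).
Qed.

Lemma card_lt_few_dense : #|E|.+1 < s -> #|F| < (s - 1) * d_n1 n.
Proof.
move=> few; have -> : s - 1 = (s - #|E|.+1) + #|E| by lia.
apply: leq_ltn_trans (subset_leq_card (sub_residual_cover F)) _.
apply: leq_ltn_trans (leq_card_setU _ _) _; rewrite mulnDl -addSn leq_add //.
  by apply: card_residual_lt; lia.
exact: (card_dense_cover_le n_large F_derangements).
Qed.

Lemma eq_dense_cover : #|E|.+1 = s -> F = \bigcup_(e in E) star graph F [set e].
Proof.
move=> /residual_eq0 res0; apply/eqP; rewrite eqEsubset; apply/andP; split.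
  by have := sub_residual_cover F; rewrite res0 set0U.
by apply/bigcupsP => e _; apply: star_sub.
Qed.

Lemma card_derangements_le : #|F| <= (s - 1) * d_n1 n.
Proof.
have [few|] := ltnP #|E|.+1 s; first exact: ltnW (card_lt_few_dense few).
rewrite leq_eqVlt ltnNge card_dense_pairs_lt orbF => /eqP Es.
rewrite [in leqLHS](eq_dense_cover (esym Es)) Es subn1 /=.
exact: (card_dense_cover_le n_large F_derangements).
Qed.

Section Equality.

Hypothesis F_extremal : #|F| = (s - 1) * d_n1 n.

Lemma card_dense_pairs_extremal : #|E|.+1 = s.
Proof.
apply/eqP; rewrite eqn_leq card_dense_pairs_lt leqNgt; apply/negP => /card_lt_few_dense.
by rewrite F_extremal ltnn.
Qed.

Lemma dense_stars_tight :
  (forall e, e \in E -> #|star graph F [set e]| = d_n1 n) /\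
  {in E &, forall e e', e != e' ->
     [disjoint star graph F [set e] & star graph F [set e']]}.
Proof.
apply: card_bigcup_tight.
  exact: (card_dense_star_le n_large F_derangements).
by rewrite -(eq_dense_cover card_dense_pairs_extremal) F_extremal -card_dense_pairs_extremal subn1.
Qed.

Lemma dense_star_full x y : (x, y) \in E -> star graph F [set (x, y)] = Dpair x y.
Proof.
move=> xyE; have [tight _] := dense_stars_tight; apply/eqP.
rewrite eqEcard star_sub_Dpair // tight // card_Dpair ?leqnn //.
exact: (dense_pair_offdiag n_large F_derangements xyE).
Qed.

Lemma extremal_eq_bigcup : F = \bigcup_(e in E) Dpair e.1 e.2.
Proof.
rewrite [LHS](eq_dense_cover card_dense_pairs_extremal).
by apply: eq_bigr => -[x y] /dense_star_full.
Qed.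

Lemma dense_pairs_collinear : collinear E.
Proof.
move=> [x y] [x' y'] xyE xyE' /=; have [_ disjE] := dense_stars_tight.
have [->|neq_x] := eqVneq x x'; first by left.
have [->|neq_y] := eqVneq y y'; first by right.
have off a b : (a, b) \in E -> a != b by apply: (dense_pair_offdiag n_large F_derangements).
have := Dpair_meet n_large (off x y xyE) (off x' y' xyE') neq_x neq_y.
rewrite -!dense_star_full // disjE //; apply: contraNneq neq_x; by case=> ->.
Qed.

Lemma extremal_collinear_union : exists E' : {set 'I_n * 'I_n},
  [/\ #|E'| = s - 1, collinear E',
      forall x y, (x, y) \in E' -> x != y & F = \bigcup_(e in E') Dpair e.1 e.2].
Proof.
exists E; split; last exact: extremal_eq_bigcup; last exact: dense_pair_offdiag.
- by rewrite -card_dense_pairs_extremal subn1.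
- exact: dense_pairs_collinear.
Qed.

End Equality.

End Families.

End SmallMatchingNumber.

Lemma collinear_Dpair_union n (E : {set 'I_n * 'I_n}) :
  0 < n -> collinear E ->
  (forall x y, (x, y) \in E -> x != y) ->
  (exists (x : 'I_n) (Y : {set 'I_n}),
     #|Y| = #|E| /\ x \notin Y /\ \bigcup_(e in E) Dpair e.1 e.2 = \bigcup_(y in Y) Dpair x y)
  \/ (exists (y : 'I_n) (X : {set 'I_n}),
     #|X| = #|E| /\ y \notin X /\ \bigcup_(e in E) Dpair e.1 e.2 = \bigcup_(x in X) Dpair x y).
Proof.
move=> n_gt0 /(collinear_line (Ordinal n_gt0)) [[x [Y ->]]|[y [X ->]]] off; [left|right].
  have inj_x : injective (fun y : 'I_n => (x, y)) by move=> ? ? [].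
  exists x, Y; rewrite card_imset // big_imset => [|? ? _ _ /inj_x //]; split=> //; split=> //.
  by apply/negP => xY; have := off x x; rewrite mem_imset // eqxx => /(_ xY).
have inj_y : injective (fun x : 'I_n => (x, y)) by move=> ? ? [].
exists y, X; rewrite card_imset // big_imset => [|? ? _ _ /inj_y //]; split=> //; split=> //.
by apply/negP => yX; have := off y y; rewrite (mem_imset _ _ inj_y) eqxx => /(_ yX).
Qed.

Lemma INR_expn m k : INR (m ^ k) = (INR m ^ k)%R.
Proof. by elim: k => [|k IHk] //; rewrite expnS mult_INR IHk. Qed.

Lemma trunc_log2_le_ln n : 0 < n -> (INR (trunc_log 2 n) / 2 <= ln (INR n))%R.
Proof.
move=> n_gt0; have pow_gt0 : (0 < 2 ^ trunc_log 2 n)%R by apply: pow_lt; lra.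
have pow_le : (2 ^ trunc_log 2 n <= INR n)%R.
  by rewrite -(INR_expn 2); apply/le_INR/leP/trunc_logP.
have : (ln (2 ^ trunc_log 2 n) <= ln (INR n))%R.
  by case: pow_le => [lt_pow|<-]; [left; apply: ln_increasing | right].
have := pos_INR (trunc_log 2 n); have := ln_lt_2; rewrite ln_pow; last by lra.
by nra.
Qed.

(* At [n <= 1] the hypothesis divides by [ln n = 0], and [/ 0 = 0] forces [s = 0]. *)
Lemma log_bound_gt1 n s : 0 < s ->
  (INR s <= INR n / (2 ^ 17 * ln (INR n)))%R -> 1 < n.
Proof.
move=> s_gt0; have s_ge1 : (1 <= INR s)%R by apply/(le_INR 1)/leP.
case: n => [|[|n]] //=; first by rewrite /Rdiv Rmult_0_l; lra.
by rewrite ln_1 Rmult_0_r /Rdiv Rinv_0; lra.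
Qed.

Lemma mul_trunc_log2_le n s : 0 < s ->
  (INR s <= INR n / (2 ^ 17 * ln (INR n)))%R -> 2 ^ 16 * (s * trunc_log 2 n) <= n.
Proof.
move=> s_gt0 s_le; have s_ge1 : (1 <= INR s)%R by apply/(le_INR 1)/leP.
have n_gt1 := log_bound_gt1 s_gt0 s_le.
have ln_ge := trunc_log2_le_ln (ltnW n_gt1); set k := trunc_log 2 n in ln_ge *.
have k_ge1 : (1 <= INR k)%R by apply/(le_INR 1)/leP; rewrite trunc_log_gt0.
have {}s_le : (INR s * (2 ^ 17 * ln (INR n)) <= INR n)%R.
  have den_gt0 : (0 < 2 ^ 17 * ln (INR n))%R by apply: Rmult_lt_0_compat; lra.
  have := Rmult_le_compat_r _ _ _ (Rlt_le _ _ den_gt0) s_le.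
  by rewrite /Rdiv Rmult_assoc Rinv_l ?Rmult_1_r //; lra.
apply/leP/INR_le; rewrite (mult_INR (2 ^ 16)) (mult_INR s) INR_expn.
have : (INR s * (INR k / 2) <= INR s * ln (INR n))%R by apply: Rmult_le_compat_l; lra.
by rewrite (_ : INR 2 = 2%R) //; lra.
Qed.

Lemma log_bounds n s : 0 < s -> (INR s <= INR n / (2 ^ 17 * ln (INR n)))%R ->
  n < 2 ^ (trunc_log 2 n).+1 /\ 96 * (2 ^ 9 * (s * (trunc_log 2 n).+1)) < n.
Proof.
move=> s_gt0 s_le; split; first exact: trunc_log_ltn.
have k_gt0 : 0 < trunc_log 2 n by rewrite trunc_log_gt0 (log_bound_gt1 s_gt0 s_le).
have := mul_trunc_log2_le s_gt0 s_le; set k := trunc_log 2 n in k_gt0 * => sk_n.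
have k_ge16 : 16 <= k.
  by rewrite trunc_log_max // (leq_trans _ sk_n) // leq_pmulr // muln_gt0 s_gt0.
have := leq_mul (leqnn s) k_ge16; rewrite mulnS; move: sk_n.
by rewrite (expnD 2 7 9) -mulnA (_ : 2 ^ 7 = 128) // (_ : 2 ^ 9 = 512) //; lia.
Qed.

Theorem theorem5 (n s : nat) (F : {set {perm 'I_n}}) :
  (INR s <= INR n / (2 ^ 17 * ln (INR n)))%R ->
  F \subset Dn n ->
  nu F < s ->
  #|F| <= (s - 1) * d_n1 n /\
  (#|F| = (s - 1) * d_n1 n ->
     (exists (x : 'I_n) (Y : {set 'I_n}),
         #|Y| = s - 1 /\ x \notin Y /\ F = \bigcup_(y in Y) Dpair x y)
     \/
     (exists (y : 'I_n) (X : {set 'I_n}),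
         #|X| = s - 1 /\ y \notin X /\ F = \bigcup_(x in X) Dpair x y)).
Proof.
move=> s_le F_derangements nuF; have s_gt0 : 0 < s by apply: leq_ltn_trans nuF.
have [n_lt_exp R_lt_n] := log_bounds s_gt0 s_le; set l := (trunc_log 2 n).+1 in n_lt_exp R_lt_n.
have R_ge := leqnn (2 ^ 9 * (s * l)); split=> [|F_extremal].
  exact: (card_derangements_le n_lt_exp R_ge).
have [E [<- collinearE offE ->]] :=
  extremal_collinear_union n_lt_exp R_ge R_lt_n s_gt0 F_derangements nuF F_extremal.
exact: collinear_Dpair_union (ltnW (log_bound_gt1 s_gt0 s_le)) collinearE offE.
Qed.
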